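(* Let $R=\{a\in\mathcal{O}^\times: (a,b)=1\text{ for all }b\in\mathcal{O}^\times\}$. Then: (1) $(1+\varpi^{2e}\mathcal{O})\,\mathcal{O}^{\times2}=R$ and $1+\varpi^{2e+1}\mathcal{O}\subseteq\mathcal{O}^{\times2}$. (2) $(1+\varpi^{2e}\mathcal{O})/\big((1+\varpi^{2e}\mathcal{O})\cap\mathcal{O}^{\times2}\big)\cong R/\mathcal{O}^{\times2}\cong\mathbb{Z}/2\mathbb{Z}$. (3) $[\mathcal{O}^\times:R]=2^{ef}$.
   Context: $F$ is a finite extension of $\mathbb{Q}_2$ with ring of integers $\mathcal{O}$, uniformizer $\varpi$, ramification index $e$ and inertia degree $f$ over $\mathbb{Q}_2$, so $2\mathcal{O}=\varpi^e\mathcal{O}$ and $[F:\mathbb{Q}_2]=ef$. $(-,-):F^\times\times F^\times\to\{\pm1\}$ is the quadratic Hilbert symbol of $F$, and $\mathcal{O}^{\times2}$ is the group of squares of units. *)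

(* Defs.v *)
From HB Require Import structures.
From mathcomp Require Import all_boot all_order all_algebra all_field.
From mathcomp Require Import boolp classical_sets functions cardinality.

Set Implicit Arguments.
Unset Strict Implicit.
Unset Printing Implicit Defensive.

Import Order.TTheory GRing.Theory Num.Theory.
Local Open Scope classical_set_scope.
Local Open Scope ring_scope.

(* The ring Z_2 of 2-adic integers, as the inverse limit of the Z/2^n Z. The
   class modulo 2^n is stored as its representative in [0, 2^n[: since modz by
   a positive number is nonnegative, compatibility implies the range condition.
   Z_2 is written Z2adic because 'Z_2 is the ring of integers modulo 2.       *)
Record Z2adic := MkZ2adic {
  z2val :> nat -> int;
  z2valP : forall n, z2val n = (z2val n.+1 %% 2 ^+ n)%Z }.

HB.instance Definition _ := gen_eqMixin Z2adic.
HB.instance Definition _ := gen_choiceMixin Z2adic.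

Lemma z2_inj (x y : Z2adic) : x =1 y -> x = y.
Proof.
case: x y => [x xP] [y yP] /= /funext exy; move: xP yP; rewrite exy => xP yP.
by congr MkZ2adic; apply: Prop_irrelevance.
Qed.

Lemma modz_modD (m : int) n k :
  ((m %% 2 ^+ (n + k))%Z %% 2 ^+ n)%Z = (m %% 2 ^+ n)%Z.
Proof.
rewrite [in RHS](divz_eq m (2 ^+ (n + k))) exprD [2 ^+ n * _]mulrC mulrA.
by rewrite modzMDl.
Qed.

Lemma z2_mod (x : Z2adic) n k : (x (n + k)%N %% 2 ^+ n)%Z = x n.
Proof.
elim: k => [|k IH]; first by rewrite addn0 z2valP modz_mod.
by rewrite -[RHS]IH [x (n + k)%N]z2valP addnS modz_modD.
Qed.

Lemma z2_lift (u : nat -> int) :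
  (forall n, (u n.+1 %% 2 ^+ n)%Z = (u n %% 2 ^+ n)%Z) ->
  forall n, (u n %% 2 ^+ n)%Z = ((u n.+1 %% 2 ^+ n.+1)%Z %% 2 ^+ n)%Z.
Proof. by move=> uP n; rewrite -[n.+1]addn1 modz_modD addn1 uP. Qed.

Lemma z2_modE (x : Z2adic) n : (x n %% 2 ^+ n)%Z = x n.
Proof. by rewrite z2valP modz_mod. Qed.

Definition z2_cst (k : int) : Z2adic :=
  MkZ2adic (@z2_lift (fun=> k) (fun=> erefl)).

Lemma z2_add_subproof (x y : Z2adic) n :
  ((x n.+1 + y n.+1) %% 2 ^+ n)%Z = ((x n + y n) %% 2 ^+ n)%Z.
Proof. by rewrite -modzDm -!z2valP. Qed.
Definition z2_add x y := MkZ2adic (z2_lift (z2_add_subproof x y)).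

Lemma z2_opp_subproof (x : Z2adic) n :
  (- x n.+1 %% 2 ^+ n)%Z = (- x n %% 2 ^+ n)%Z.
Proof. by rewrite -modzNm -z2valP. Qed.
Definition z2_opp x := MkZ2adic (z2_lift (z2_opp_subproof x)).

Lemma z2_mul_subproof (x y : Z2adic) n :
  ((x n.+1 * y n.+1) %% 2 ^+ n)%Z = ((x n * y n) %% 2 ^+ n)%Z.
Proof. by rewrite -modzMm -!z2valP. Qed.
Definition z2_mul x y := MkZ2adic (z2_lift (z2_mul_subproof x y)).

Lemma z2_addA : associative z2_add.
Proof. by move=> x y z; apply: z2_inj => n /=; rewrite modzDml modzDmr addrA. Qed.
Lemma z2_addC : commutative z2_add.
Proof. by move=> x y; apply: z2_inj => n /=; rewrite addrC. Qed.
Lemma z2_add0 : left_id (z2_cst 0) z2_add.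
Proof. by move=> x; apply: z2_inj => n /=; rewrite mod0z add0r z2_modE. Qed.
Lemma z2_addN : left_inverse (z2_cst 0) z2_opp z2_add.
Proof. by move=> x; apply: z2_inj => n /=; rewrite modzDml addNr. Qed.

HB.instance Definition _ := GRing.isZmodule.Build Z2adic z2_addA z2_addC z2_add0 z2_addN.

Lemma z2_mulA : associative z2_mul.
Proof. by move=> x y z; apply: z2_inj => n /=; rewrite modzMml modzMmr mulrA. Qed.
Lemma z2_mulC : commutative z2_mul.
Proof. by move=> x y; apply: z2_inj => n /=; rewrite mulrC. Qed.
Lemma z2_mul1 : left_id (z2_cst 1) z2_mul.
Proof. by move=> x; apply: z2_inj => n /=; rewrite modzMml mul1r z2_modE. Qed.
Lemma z2_mulDl : left_distributive z2_mul z2_add.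
Proof.
by move=> x y z; apply: z2_inj => n /=; rewrite modzMml modzDm mulrDl.
Qed.
Lemma z2_one_neq0 : z2_cst 1 != 0 :> Z2adic.
Proof. by apply/eqP => /(congr1 (fun x : Z2adic => x 1%N)). Qed.

HB.instance Definition _ := GRing.Zmodule_isComNzRing.Build Z2adic
  z2_mulA z2_mulC z2_mul1 z2_mulDl z2_one_neq0.

Definition z2_unit : {pred Z2adic} := [pred x | `[< exists y, y * x = 1 >]].
Definition z2_inv (x : Z2adic) : Z2adic := xget x [set y | y * x = 1].

Lemma z2_mulV : {in z2_unit, left_inverse 1 z2_inv *%R}.
Proof.
move=> x /asboolP [y yx]; rewrite /z2_inv; case: xgetP => [z _ //|].
by move=> /(_ y) /(_ yx).
Qed.
Lemma z2_unitP (x y : Z2adic) : y * x = 1 -> z2_unit x.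
Proof. by move=> yx; apply/asboolP; exists y. Qed.
Lemma z2_inv_out : {in [predC z2_unit], z2_inv =1 id}.
Proof.
move=> x /asboolP xU; rewrite /z2_inv; case: xgetP => [z _ zx|//].
by case: xU; exists z.
Qed.

HB.instance Definition _ := GRing.ComNzRing_hasMulInverse.Build Z2adic
  z2_mulV z2_unitP z2_inv_out.

Lemma z2_neq0P (x : Z2adic) : x != 0 -> exists n, x n != 0.
Proof.
move=> x0; apply: contrapT => H; move/eqP: x0; apply.
apply: z2_inj => n /=; rewrite mod0z; apply/eqP; apply: contrapT => xn.
by apply: H; exists n; apply/negP.
Qed.

Lemma z2_ndvd_lift (x : Z2adic) n k :
  x n != 0 -> ~~ (2 ^+ n %| x (n + k)%N)%Z.
Proof. by apply: contra => /dvdz_mod0P; rewrite z2_mod => ->. Qed.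

Lemma z2_mulf_eq0 : GRing.integral_domain_axiom Z2adic.
Proof.
move=> x y xy0; apply/norP => -[/z2_neq0P [n xn] /z2_neq0P [m ym]].
have := congr1 (fun z : Z2adic => z (n + m)%N) xy0.
rewrite /= mod0z => /dvdz_mod0P.
have := z2_ndvd_lift m xn; have := z2_ndvd_lift n ym; rewrite [(m + n)%N]addnC.
move: (x _) (y _) => X Y.
rewrite !dvdzE abszM !abszX; change `|2 : int|%N with 2%N.
move: `|X|%N `|Y|%N => a b.
have [->|b0] := posnP b; first by rewrite dvdn0.
have [->|a0] := posnP a; first by rewrite dvdn0.
rewrite !pfactor_dvdn ?muln_gt0 ?a0 // lognM // -!ltnNge => bm an.
by apply/negP; rewrite -ltnNge -addnS leq_add // ltnW.
Qed.

HB.instance Definition _ :=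
  GRing.ComUnitRing_isIntegral.Build Z2adic z2_mulf_eq0.

Notation Q2adic := {fraction Z2adic}.

(* Groups, subgroups and quotients are handled as subsets of an ambient type
   with a binary operation.                                                   *)

Definition setop (T : Type) (op : T -> T -> T) (A B : set T) : set T :=
  [set op a b | a in A & b in B].

Definition cosets (T : Type) (op : T -> T -> T) (G N : set T) : set (set T) :=
  [set [set op g n | n in N] | g in G].

Definition group_iso (T U : Type) (opT : T -> T -> T) (A : set T)
    (opU : U -> U -> U) (B : set U) : Prop :=
  exists f : T -> U, set_bij A B f /\
    forall x y, A x -> A y -> A (opT x y) /\ f (opT x y) = opU (f x) (f y).

(* The value at 0 is irrelevant: only the restriction to nonzero arguments is
   the Hilbert symbol.                                                        *)
Definition hilbert (K : fieldType) (a b : K) : int :=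
  if `[< exists x y z : K, (x, y, z) != (0, 0, 0)
           /\ z ^+ 2 = a * x ^+ 2 + b * y ^+ 2 >] then 1 else -1.

Section LocalField.
Variable F : fieldExtType Q2adic.

Definition Z2adic_to (x : Z2adic) : F := (FracField.tofrac x)%:A.

Definition ringint : set F := [set x | integralOver Z2adic_to x].

Definition unitint : set F :=
  [set x | ringint x /\ exists2 y, ringint y & x * y = 1].

(* The ring of integers is local, so its maximal ideal is its set of nonunits. *)
Definition maxideal : set F := ringint `\` unitint.

Definition principal (a : F) : set F := [set a * x | x in ringint].

Definition uniformizer (w : F) : Prop := maxideal = principal w.

Definition ramification_index (w : F) (e : nat) : Prop :=
  principal 2 = principal (w ^+ e).

(* The residue field has dimension f over 'F_2; an additive map between
   'F_2-vector spaces is automatically 'F_2-linear.                           *)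
Definition inertia_degree (f : nat) : Prop :=
  group_iso (setop +%R) (cosets +%R ringint maxideal) +%R [set: 'rV['F_2]_f].

Definition one_plus (a : F) : set F := [set 1 + x | x in principal a].

Definition unit_squares : set F := [set u ^+ 2 | u in unitint].

Definition hilbert_radical : set F :=
  [set a | unitint a /\ forall b, unitint b -> hilbert a b = 1].

End LocalField.

Arguments ringint : clear implicits.
Arguments unitint : clear implicits.
Arguments maxideal : clear implicits.
Arguments unit_squares : clear implicits.
Arguments hilbert_radical : clear implicits.

(* Main.v *)
(* Everything about O is derived from three facts: O is a discrete valuation
   ring with finite residue field, 2 = w^e * unit, and O is complete. A Hensel
   lemma for v = w d + c v^2 shows that 1 + 4c is a square iff T^2 + T - c has a
   root in the residue field k; since the additive map T^2 + T of k has kernel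
   {0, 1}, its image has index 2, whence (2) and 1 + 4wO in the squares.
     For a = 1 + 4c every unit is a value of the norm form x^2 + xy - c y^2 (k is
   perfect), so a lies in R. A unit outside (1 + 4O) O^x2 is a square times
   1 + w^k c with k < 2e odd and c a unit; pairing it with 1 + 4g / (w^k c), where
   T^2 + T + g has no root in k, gives Hilbert symbol -1.
     Finally O^x / R is the cokernel of squaring on the finite abelian group
   (O / 4O)^x, hence has as many elements as its kernel (1 + 2O) / (1 + 4O), which
   is in bijection with O / 2O. *)

From HB Require Import structures.
Require Import Defs.
From mathcomp Require Import all_boot all_order all_algebra all_field.
From mathcomp Require Import all_fingroup.
From mathcomp Require Import boolp classical_sets functions cardinality.
From mathcomp Require Import ring.

Set Implicit Arguments.
Unset Strict Implicit.
Unset Printing Implicit Defensive.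

Import Order.TTheory GRing.Theory Num.Theory.
Local Open Scope classical_set_scope.
Local Open Scope card_scope.
Local Open Scope ring_scope.

(** * Discrete valuation rings *)

Definition multiples (K : fieldType) (O : set K) (a : K) : set K :=
  [set a * x | x in O].

Definition units (K : fieldType) (O : set K) : set K :=
  [set x | O x /\ exists2 y, O y & x * y = 1].

(** The valuation is left implicit: [dvr_nonunit] says that [O] is local with maximal ideal [w O],
    [dvr_sep] excludes infinite valuation away from 0, and [dvr_frac] makes [K] the fraction field
    of [O]. *)
Record dvr (K : fieldType) (O : set K) (w : K) : Prop := Dvr {
  dvr1 : O 1;
  dvrB : forall x y, O x -> O y -> O (x - y);
  dvrM : forall x y, O x -> O y -> O (x * y);
  dvr_nonunit : O `\` units O = multiples O w;
  dvr_neq0 : w != 0;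
  dvr_sep : forall x, (forall n, multiples O (w ^+ n) x) -> x = 0;
  dvr_frac : forall x, exists d, [/\ O d, d != 0 & O (d * x)] }.

Section DvrTheory.
Variables (K : fieldType) (O : set K) (w : K).
Hypothesis D : dvr O w.
Implicit Types x y u v : K.

Let O1 := dvr1 D.
Let OB x y := dvrB D (x := x) (y := y).
Let OM x y := dvrM D (x := x) (y := y).
Let w0 := dvr_neq0 D.

Lemma dvr0 : O 0. Proof. by rewrite -(subrr 1); apply: OB. Qed.
Lemma dvrN x : O x -> O (- x).
Proof. by move=> Ox; rewrite -sub0r; apply: OB => //; apply: dvr0. Qed.
Lemma dvrD x y : O x -> O y -> O (x + y).
Proof. by move=> Ox Oy; rewrite -[y]opprK; apply: OB => //; apply: dvrN. Qed.
Lemma dvrX x n : O x -> O (x ^+ n).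
Proof. by move=> Ox; elim: n => // n IH; rewrite exprS; apply: OM. Qed.

Lemma dvr_unitP x : O x -> multiples O w x \/ units O x.
Proof.
move=> Ox; have [|NU] := pselect (units O x); [by right | left].
by rewrite -(dvr_nonunit D).
Qed.

Lemma multiples_nonunit x : multiples O w x -> ~ units O x.
Proof. by rewrite -(dvr_nonunit D) => -[]. Qed.

Lemma multiples_sub a x : O a -> multiples O a x -> O x.
Proof. by move=> Oa [y Oy <-]; apply: OM. Qed.

Lemma dvrw : O w.
Proof.
suff [] : (O `\` units O) w by [].
by rewrite (dvr_nonunit D); exists 1; rewrite ?mulr1.
Qed.

Lemma multiples0 a : multiples O a 0.
Proof. by exists 0; [apply: dvr0 | rewrite mulr0]. Qed.

Lemma multiplesD a x y :
  multiples O a x -> multiples O a y -> multiples O a (x + y).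
Proof.
by move=> [r Or <-] [s Os <-]; exists (r + s); [apply: dvrD | rewrite mulrDr].
Qed.

Lemma multiplesMl a r x : O r -> multiples O a x -> multiples O a (r * x).
Proof.
by move=> Or [s Os <-]; exists (r * s); [apply: OM | rewrite mulrCA].
Qed.

Lemma multiplesN a x : multiples O a x -> multiples O a (- x).
Proof. by move=> [s Os <-]; exists (- s); [apply: dvrN | rewrite mulrN]. Qed.

Lemma multiplesB a x y :
  multiples O a x -> multiples O a y -> multiples O a (x - y).
Proof. by move=> ax ay; apply/multiplesD/multiplesN. Qed.

Lemma multiplesX m n x :
  (m <= n)%N -> multiples O (w ^+ n) x -> multiples O (w ^+ m) x.
Proof.
move=> /subnKC<- [y Oy <-]; exists (w ^+ (n - m) * y).
  by apply: OM => //; apply/dvrX/dvrw.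
by rewrite mulrA -exprD.
Qed.

Lemma unitsE u : units O u <-> [/\ O u, u != 0 & O u^-1].
Proof.
split=> [[Ou [v Ov uv1]]|[Ou u0 Ov]]; last by split=> //; exists u^-1;
  rewrite ?divff.
have u0 : u != 0 by apply: contra_eq_neq uv1 => ->; rewrite mul0r eq_sym oner_eq0.
by split=> //; rewrite -[u^-1]mulr1 -uv1 mulKf.
Qed.

Lemma units_dvr u : units O u -> O u. Proof. by case. Qed.
Lemma units_neq0 u : units O u -> u != 0. Proof. by case/unitsE. Qed.

Lemma units1 : units O 1. Proof. by split=> //; exists 1; rewrite ?mulr1. Qed.

Lemma unitsM u v : units O u -> units O v -> units O (u * v).
Proof.
move=> /unitsE[Ou u0 OVu] /unitsE[Ov v0 OVv]; apply/unitsE; split.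
- exact: OM.
- by rewrite mulf_neq0.
- by rewrite invfM; apply: OM.
Qed.

Lemma unitsV u : units O u -> units O u^-1.
Proof. by case/unitsE=> Ou u0 OVu; apply/unitsE; rewrite invr_eq0 invrK. Qed.

Lemma unitsX u n : units O u -> units O (u ^+ n).
Proof.
by move=> Uu; elim: n => [|n IH]; [apply: units1 | rewrite exprS; apply: unitsM].
Qed.

Lemma unitsDm u x : units O u -> multiples O w x -> units O (u + x).
Proof.
move=> Uu wx; have Ou := units_dvr Uu; have Ox := multiples_sub dvrw wx.
have [wux|//] := dvr_unitP (dvrD Ou Ox).
by case: (multiples_nonunit _ Uu); rewrite -(addrK x u); apply: multiplesB.
Qed.

Lemma multiples_unit a u x :
  units O u -> multiples O (a * u) x <-> multiples O a x.
Proof.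
case/unitsE=> Ou u0 OVu; split=> -[y Oy <-].
  by exists (u * y); [apply: OM | rewrite mulrA].
by exists (u^-1 * y); [apply: OM | rewrite -mulrA mulVKf].
Qed.

(** If splitting off factors [w] never left a unit, [x] would be divisible by every [w ^+ n], hence
    0 by [dvr_sep]. *)
Lemma dvr_val x : O x -> x != 0 -> exists n, exists2 u, units O u & x = w ^+ n * u.
Proof.
move=> Ox x0; apply: contrapT => H; move/eqP: x0; apply; apply: (dvr_sep D).
elim=> [|n [y Oy Ey]]; first by exists x; rewrite ?expr0 ?mul1r.
have [[z Oz Ez]|Uy] := dvr_unitP Oy.
  by exists z => //; rewrite -Ey -Ez exprSr -mulrA.
by case: H; exists n, y.
Qed.

Lemma dvr_val_inj m n u v :
  units O u -> units O v -> w ^+ m * u = w ^+ n * v -> m = n.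
Proof.
have aux k l r s : units O r -> units O s -> w ^+ k * r = w ^+ (k + l.+1) * s ->
  False.
  move=> Ur Us; rewrite exprD -mulrA => /(mulfI (expf_neq0 _ w0)) E.
  apply: (multiples_nonunit _ Ur); exists (w ^+ l * s).
    by apply: OM (units_dvr Us); apply/dvrX/dvrw.
  by rewrite E exprS mulrA.
move=> Uu Uv E; have [lt_mn|lt_nm|//] := ltngtP m n.
  by case: (aux m (n - m).-1 u v) => //; rewrite prednK ?subn_gt0 // subnKC // ltnW.
by case: (aux n (m - n).-1 v u) => //; rewrite prednK ?subn_gt0 // subnKC // ltnW.
Qed.

(** Write [x] as a quotient of two elements of [O] and compare their exponents of [w]. *)
Lemma dvr_dichotomy x : O x \/ multiples O w x^-1.
Proof.
have [->|x0] := eqVneq x 0; first by left; apply: dvr0.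
have [d [Od d0 Odx]] := dvr_frac D x.
have [m [u Uu Eu]] := dvr_val Od d0.
have [n [v Uv Ev]] := dvr_val Odx (mulf_neq0 d0 x0).
have u0 := units_neq0 Uu; have v0 := units_neq0 Uv.
have Ouv := units_dvr (unitsM Uv (unitsV Uu)).
have Ovu := units_dvr (unitsM Uu (unitsV Uv)).
have Ex : x = w ^+ n * v / (w ^+ m * u) by rewrite -Ev -Eu mulrC mulKf.
have [le_mn|lt_nm] := leqP m n; [left | right].
  rewrite Ex -(subnKC le_mn) exprD.
  have ->: w ^+ m * w ^+ (n - m) * v / (w ^+ m * u) = w ^+ (n - m) * (v / u).
    by field; rewrite ?u0 ?expf_neq0.
  by apply: OM => //; apply/dvrX/dvrw.
exists (w ^+ (m - n.+1) * (u / v)); first by apply: OM => //; apply/dvrX/dvrw.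
rewrite Ex -[in w ^+ m](subnKC lt_nm) exprD exprS.
by field; rewrite ?w0 ?u0 ?v0 ?expf_neq0.
Qed.

(** Integral closedness in degree 2: for [x] outside [O], dividing the equation by [x ^+ 2] would
    put 1 in [w O]. *)
Lemma dvr_root_monic2 x b c : O b -> O c -> x ^+ 2 + b * x = c -> O x.
Proof.
move=> Ob Oc E; have [//|wVx] := dvr_dichotomy x.
have [->|x0] := eqVneq x 0; first exact: dvr0.
have OVx := multiples_sub dvrw wVx.
have: 1 = (c * x^-1 - b) * x^-1 by rewrite -E; field.
move=> E1; case: (multiples_nonunit _ units1).
by rewrite E1; apply: multiplesMl => //; apply: OB => //; apply: OM.
Qed.

End DvrTheory.

(** * Residue map and Hensel lemma *)

(** [V] carries only the additive structure of the residue field; products in it are computed on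
    lifts to [O]. *)
Record residue_map (K : fieldType) (O : set K) (w : K) (V : finZmodType)
    (r : K -> V) : Prop := ResidueMap {
  resD : forall x y, O x -> O y -> r (x + y) = r x + r y;
  res_surj : forall v, exists2 x, O x & r x = v;
  res_ker : forall x, O x -> (r x = 0 <-> multiples O w x) }.

(** [T] models [O / a O] as a bare finite set, with class map [q] (meaningful on [O] only) and
    system of representatives [s]. *)
Record finite_quotient (K : fieldType) (O : set K) (a : K) (T : finType)
    (q : K -> T) (s : T -> K) : Prop := FiniteQuotient {
  fq_repr : forall t, O (s t);
  fq_reprK : cancel s q;
  fq_eq : forall x y, O x -> O y -> (q x = q y <-> multiples O a (x - y)) }.

Section Residue.
Variables (K : fieldType) (O : set K) (w : K) (V : finZmodType) (r : K -> V).
Hypotheses (D : dvr O w) (rP : residue_map O w r).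

Lemma res_eq x y : O x -> O y -> (r x = r y <-> multiples O w (x - y)).
Proof.
move=> Ox Oy; have Oxy := dvrB D Ox Oy; rewrite -(res_ker rP Oxy).
have E := resD rP Oxy Oy; rewrite subrK in E.
by rewrite E; split=> [/(canRL (addrK _))->|->]; rewrite ?subrr ?add0r.
Qed.

Lemma res_repr : exists s : V -> K, (forall v, O (s v)) /\ cancel s r.
Proof.
have /choice[s sP] v : exists x, O x /\ r x = v by have [x] := res_surj rP v;
  exists x.
by exists s; split=> v; have [] := sP v.
Qed.

(** Digit expansion: a class modulo [w ^+ n.+1] is a class modulo [w ^+ n] together with the residue
    of the next digit [m x]. *)
Lemma finite_quotient_exists n : exists (T : finType) (q : K -> T) (s : T -> K),
  #|T| = (#|V| ^ n)%N /\ finite_quotient O (w ^+ n) q s.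
Proof.
have w0 := dvr_neq0 D.
elim: n => [|n [T [q [s [cT [sO sK qE]]]]]].
  exists unit, (fun=> tt), (fun=> 0); rewrite card_unit expn0; split=> //; split.
  - by move=> _; apply: (dvr0 D).
  - by case.
  - by move=> x y Ox Oy; split=> // _; exists (x - y); rewrite ?mul1r //;
    apply: (dvrB D).
have [rho [rhoO rhoK]] := res_repr.
pose m x := (x - s (q x)) / w ^+ n.
have mE x : x = s (q x) + w ^+ n * m x by rewrite /m mulrCA divff ?expf_neq0 //
  mulr1 subrKC.
have mO x : O x -> O (m x).
  move=> Ox; have [|y Oy Ey] := (qE x (s (q x)) Ox (sO _)).1; first by rewrite sK.
  by rewrite /m -Ey mulrC mulKf ?expf_neq0.
exists (T * V)%type, (fun x => (q x, r (m x))), (fun t => s t.1 + w ^+ n * rho t.2).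
have wO k : O (w ^+ k) by apply/(dvrX D)/(dvrw D).
rewrite card_prod cT expnSr; split=> //; split.
- by move=> [t v] /=; apply: (dvrD D) => //; apply: (dvrM D).
- move=> [t v] /=; set x := _ + _.
  have Ox : O x by apply: (dvrD D) => //; apply: (dvrM D).
  have qx : q x = t.
    rewrite -(sK t); apply/(qE _ _ Ox (sO _)); rewrite /x addrC addKr.
    by exists (rho v).
  by rewrite qx /m qx /x addrC addKr mulrC mulKf ?expf_neq0 // rhoK.
- move=> x y Ox Oy; split=> [[qxy /res_eq]|].
    move=> /(_ (mO _ Ox) (mO _ Oy)) [z Oz Ez].
    exists z => //; rewrite [in RHS](mE x) [in RHS](mE y) qxy exprSr -mulrA Ez.
    by ring.
  move=> mxy; have qxy : q x = q y.
    by apply/(qE _ _ Ox Oy); apply: (multiplesX D (leqnSn n) mxy).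
  congr pair => //; apply/res_eq; [exact: mO | exact: mO|].
  have [z Oz Ez] := mxy; exists z => //.
  by rewrite /m qxy -mulrBl opprB addrA subrK -Ez exprSr; field; rewrite expf_neq0.
Qed.
End Residue.

(* Completeness is stated through the tails S n of the series
   sum_k 2^k x_(n + k). *)
Record dyadic (K : fieldType) (O : set K) (w : K) (e : nat) : Prop := Dyadic {
  dyadic_gt0 : (0 < e)%N;
  dyadic2 : exists2 u, units O u & 2 = w ^+ e * u;
  dyadic_complete : forall x : nat -> K, (forall n, O (x n)) ->
    exists S : nat -> K, forall n, O (S n) /\ S n = x n + 2 * S n.+1 }.

Section Hensel.
Variables (K : fieldType) (O : set K) (w : K) (e : nat).
Hypotheses (D : dvr O w) (Y : dyadic O w e).

Let O1 := dvr1 D.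
Let OD x y := dvrD D (x := x) (y := y).
Let OB x y := dvrB D (x := x) (y := y).
Let OM x y := dvrM D (x := x) (y := y).
Let Ow := dvrw D.

Lemma dyadic_2 : O 2. Proof. exact: OD. Qed.
Let O2 := dyadic_2.

Lemma dyadic_2_neq0 : 2 != 0 :> K.
Proof.
have [u Uu ->] := dyadic2 Y.
by rewrite mulf_neq0 ?expf_neq0 ?(dvr_neq0 D) // (units_neq0 Uu).
Qed.

Lemma multiples_2X n x :
  multiples O (2 ^+ n) x <-> multiples O (w ^+ (e * n)) x.
Proof.
have [u Uu ->] := dyadic2 Y.
by rewrite exprMn -exprM; apply: (multiples_unit D); apply: (unitsX D).
Qed.

Lemma multiples_w2 x : O x -> multiples O w (2 * x).
Proof.
move=> Ox; rewrite -(expr1 w); apply: (multiplesX D (dyadic_gt0 Y)).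
by rewrite -[e]muln1; apply/multiples_2X; exists x.
Qed.

(** The map [v -> w d + c v^2] is a [w]-adic contraction on [w O]; the solution is the limit of its
    iterates from 0. *)
Lemma hensel c d : O c -> O d ->
  exists2 v, multiples O w v & v = w * d + c * v ^+ 2.
Proof.
move=> Oc Od.
pose v n := iter n (fun v => w * d + c * v ^+ 2) 0.
have vS n : v n.+1 = w * d + c * v n ^+ 2 by [].
have wv n : multiples O w (v n).
  elim: n => [|n IH]; first exact: (multiples0 D).
  rewrite vS; apply: (multiplesD D); first by exists d.
  apply: (multiplesMl D) => //; rewrite expr2; apply: (multiplesMl D) => //.
  exact: (multiples_sub D Ow IH).
have Ov n : O (v n) by apply: (multiples_sub D Ow (wv n)).
have step n : multiples O (w ^+ n) (v n.+1 - v n).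
  elim: n => [|n IH]; first by rewrite expr0; exists (v 1 - v 0);
    [apply: OB | rewrite mul1r].
  have [z Oz Ez] := IH; have [y Oy Ey] := multiplesD D (wv n.+1) (wv n).
  exists (z * (y * c)); first by do !apply: OM.
  rewrite exprSr; have -> : w ^+ n * w * (z * (y * c)) = (w ^+ n * z) * (w * y) *
    c by ring.
  have -> : v n.+2 - v n.+1 = c * (v n.+1 ^+ 2 - v n ^+ 2).
    by rewrite (vS n.+1) {2}(vS n); ring.
  by rewrite Ez Ey; ring.
have steps n k : multiples O (w ^+ n) (v (n + k)%N - v n).
  elim: k => [|k IH]; first by rewrite addn0 subrr; apply: (multiples0 D).
  rewrite addnS -[v _.+1](subrK (v (n + k)%N)) -addrA; apply: (multiplesD D) => //.
  exact: (multiplesX D (leq_addr k n) (step _)).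
(* Completeness concerns series in powers of 2, so only every [e]-th iterate is kept: consecutive
   ones then differ by a multiple of [2 ^+ n], and [S 0] is the limit. *)
pose x n := (v (e * n.+1)%N - v (e * n)%N) / 2 ^+ n.
have two0 n : 2 ^+ n != 0 :> K by rewrite expf_neq0 ?dyadic_2_neq0.
have [n|S SP] := dyadic_complete Y (x := x).
  have /multiples_2X[y Oy Ey] := steps (e * n)%N e.
  by rewrite /x mulnS addnC -Ey mulrC mulKf.
have LE n : S 0 = v (e * n)%N + 2 ^+ n * S n.
  elim: n => [|n ->]; first by rewrite muln0 expr0 mul1r add0r.
  by rewrite (SP n).2 mulrDr /x mulrCA divff // exprS; ring.
have wL : multiples O w (S 0).
  by rewrite (LE 1) expr1; apply: (multiplesD D) => //; apply/multiples_w2/(SP 1).1.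
exists (S 0) => //; apply/eqP; rewrite -subr_eq0; apply/eqP/(dvr_sep D) => n.
have le_n : (n <= e * n)%N by rewrite leq_pmull // (dyadic_gt0 Y).
apply: (multiplesX D le_n).
have mL : multiples O (w ^+ (e * n)) (S 0 - v (e * n)%N).
  by apply/multiples_2X; exists (S n);
    [apply: (SP n).1 | rewrite (LE n) addrC addKr].
(* The defect of [S 0] splits into three multiples of [w ^+ (e * n)]: the distance to an iterate,
   one iteration step, and the difference of the quadratic terms. *)
have -> : S 0 - (w * d + c * S 0 ^+ 2) = (S 0 - v (e * n)%N)
    - (v (e * n).+1 - v (e * n)%N) - (c * (S 0 + v (e * n)%N)) * (S 0 - v (e *
      n)%N).
  by rewrite vS; ring.
apply: (multiplesB D); first exact: (multiplesB D mL (step _)).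
by apply: (multiplesMl D) => //; apply: OM => //; apply: OD => //; apply: (SP 0).1.
Qed.

(** Substituting [t + v] gives [v^2 + (1 + 2t) v = w g]; as [1 + 2t] is a unit, division by it
    yields the shape solved by [hensel]. *)
Lemma artin_schreier_lift c t : O c -> O t ->
  multiples O w (t ^+ 2 + t - c) -> exists2 y, O y & y ^+ 2 + y = c.
Proof.
move=> Oc Ot /(multiplesN D) [g Og Eg].
have U : units O (1 + 2 * t) by apply: (unitsDm D (units1 D)); apply: multiples_w2.
have u0 := units_neq0 U; have OV := units_dvr (unitsV U).
have [v wv Ev] := hensel (dvrN D OV) (OM Og OV).
exists (t + v); first by apply: OD => //; apply: (multiples_sub D Ow wv).
have E : v ^+ 2 = w * g - v * (1 + 2 * t) by rewrite {2}Ev; field.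
have -> : (t + v) ^+ 2 + (t + v) = t ^+ 2 + t + v * (1 + 2 * t) + v ^+ 2 by ring.
by rewrite E Eg; ring.
Qed.

(** The substitution [s = 1 + 2y] exchanges the two equations, and [(s - 1) / 2] lies in [O] as a
    root of the monic polynomial [T^2 + T - c]. *)
Lemma square_one_plus4 c : O c ->
  (exists2 s, units O s & s ^+ 2 = 1 + 4 * c) <-> (exists2 y, O y & y ^+ 2 + y = c).
Proof.
have -> : 4 = 2 ^+ 2 :> K by rewrite -natrX.
have two0 := dyadic_2_neq0.
have four0 : 4 != 0 :> K by rewrite -[4]/((2 * 2)%:R) natrM mulf_neq0.
move=> Oc; split=> [[s Us Es]|[y Oy <-]].
  have E : ((s - 1) / 2) ^+ 2 + (s - 1) / 2 = c.
    have -> : ((s - 1) / 2) ^+ 2 + (s - 1) / 2 = (s ^+ 2 - 1) / 2 ^+ 2.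
      by field; rewrite ?four0 ?two0.
    by rewrite Es; field; rewrite ?four0 ?two0.
  exists ((s - 1) / 2) => //; apply: (dvr_root_monic2 D O1 Oc).
  by rewrite mul1r.
exists (1 + 2 * y); last by ring.
by apply: (unitsDm D (units1 D)); apply: multiples_w2.
Qed.

End Hensel.

(** A kernel of order 2 forces an image of index 2, so two elements outside the image differ by an
    element of it. *)
Lemma kernel2_image (V : finZmodType) (h : V -> V) (a : V) :
    {morph h : x y / x + y} -> a != 0 ->
    (forall x, h x = 0 <-> x = 0 \/ x = a) ->
  (exists c, forall x, h x != c) /\
  (forall c d, (forall x, h x != c) -> (forall x, h x != d) ->
     exists x, h x = d - c).
Proof.
move=> hD a0 hK; pose I := [set h x | x : V]%SET.
have h0 : h 0 = 0 by apply/hK; left.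
have hB : {morph h : x y / x - y}.
  by move=> x y; apply: (addIr (h y)); rewrite -hD !subrK.
have notI c : (forall x, h x != c) <-> c \notin I.
  split=> [Hc|cI x]; first by apply/imsetP => -[x _ /eqP];
    rewrite eq_sym (negPf (Hc x)).
  by apply: contraNneq cI => <-; apply: imset_f.
have le_V : (#|V| <= #|I| * 2)%N.
  have /fin_all_exists[s sP] (y : V) : exists x, y \in I -> h x = y.
    case: (boolP (y \in I)) => [/imsetP[x _ ->]|_]; last by exists 0.
    by exists x.
  have sh x : h (s (h x)) = h x by apply/sP/imset_f.
  have -> : (#|I| * 2 = #|finset.setX I [set: bool]|)%N by rewrite cardsX cardsT
    card_bool.
  rewrite -cardsT -(card_in_imset (f := fun x => (h x, x == s (h x)))).
    apply: subset_leq_card; apply/fintype.subsetP=> _ /imsetP[x _ ->].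
    by rewrite !inE andbT /= imset_f.
  move=> x y _ _ [hxy].
  (* Each fibre of [h] consists of the chosen preimage and its translate by [a], so [x] is
     determined by [h x] and one bit. *)
  have E z : z != s (h z) -> z = s (h z) + a.
    move=> zs; apply/eqP; rewrite addrC -subr_eq; apply/eqP.
    have : h (z - s (h z)) = 0 by rewrite hB sh subrr.
    by case/hK=> // /eqP; rewrite subr_eq0 (negPf zs).
  have [ey|ny] := eqVneq y (s (h y)); have [ex|nx] := eqVneq x (s (h x)) => // _.
    by rewrite ex ey hxy.
  by rewrite (E x nx) (E y ny) hxy.
split.
  have [[c /notI Hc]|H] := pselect (exists c, c \notin I); first by exists c.
  have h_inj : injective h.
    suff /imset_injP hI : #|I| == #|V| by move=> x y; apply: hI.
    apply/eqP/eq_card => c; rewrite inE.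
    by apply/negP => /negP cI; apply: H; exists c.
  by case/eqP: a0; apply: h_inj; rewrite h0; apply/hK; right.
move=> c d /notI cI /notI dI.
(* [J] is a coset of [I] disjoint from it; by the cardinality bound the two cover [V]. *)
pose J := [set y + c | y in I]%SET.
have cJ : #|J| = #|I| by apply: card_imset; apply: addIr.
have IJ0 : I :&: J = finset.set0.
  apply/eqP; rewrite -finset.subset0; apply/fintype.subsetP => z; rewrite !inE.
  case/andP=> /imsetP[x _ ->] /imsetP[_ /imsetP[y _ ->] /eqP].
  rewrite addrC -subr_eq -hB => /eqP E.
  by case/imsetP: cI; exists (x - y); rewrite ?E.
have IJ : I :|: J = finset.setT.
  apply/eqP; rewrite eqEcard finset.subsetT cardsT cardsU IJ0 cards0 subn0 cJ.
  by rewrite addnn -muln2.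
have : d \in I :|: J by rewrite IJ inE.
rewrite inE (negPf dI) => /imsetP[_ /imsetP[x _ ->] ->].
by exists x; rewrite addrK.
Qed.

(** * Hilbert symbols of units *)

Lemma hilbertP (K : fieldType) (a b : K) :
  hilbert a b = 1 <-> exists x y z : K, (x, y, z) != (0, 0, 0)
    /\ z ^+ 2 = a * x ^+ 2 + b * y ^+ 2.
Proof. by rewrite /hilbert; case: asboolP; split. Qed.

Lemma hilbert_mul_square (K : fieldType) (a b s : K) : s != 0 ->
  hilbert a b = 1 -> hilbert (a * s ^+ 2) b = 1.
Proof.
move=> s0 /hilbertP[x [y [z [nz E]]]]; apply/hilbertP.
exists (x / s), y, z; split; last by rewrite E; field.
apply: contra nz; rewrite !xpair_eqE => /andP[/andP[xs0 ->] ->].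
by rewrite mulf_eq0 invr_eq0 (negPf s0) orbF in xs0; rewrite xs0.
Qed.

Section Radical.
Variables (K : fieldType) (O : set K) (w : K) (e : nat).
Variables (V : finZmodType) (r : K -> V).
Hypotheses (D : dvr O w) (Y : dyadic O w e) (rP : residue_map O w r).

Let O1 := dvr1 D.
Let OD x y := dvrD D (x := x) (y := y).
Let OB x y := dvrB D (x := x) (y := y).
Let OM x y := dvrM D (x := x) (y := y).
Let OX x n := dvrX D (x := x) n.
Let Ow := dvrw D.
Let w0 := dvr_neq0 D.
Let O2 : O 2 := dyadic_2 D.
Let two0 : 2 != 0 :> K := dyadic_2_neq0 D Y.

(** The residue field is perfect: since 2 is in [w O], squaring is injective on it, hence bijective
    by finiteness. *)
Lemma residue_sqrt x : O x -> exists2 t, O t & multiples O w (x - t ^+ 2).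
Proof.
have [s [sO sK]] := res_repr rP.
move=> Ox; pose phi v := r (s v ^+ 2).
have phi_inj : injective phi.
  move=> u v /(res_eq D rP (OX 2 (sO u)) (OX 2 (sO v))) H.
  rewrite -(sK u) -(sK v); apply/(res_eq D rP) => //.
  have [//|U] := dvr_unitP D (OB (sO u) (sO v)).
  case: (multiples_nonunit D _ (unitsX D 2 U)).
  have -> : (s u - s v) ^+ 2 = s u ^+ 2 - s v ^+ 2 - 2 * (s v * (s u - s v)) by
    ring.
  by apply: (multiplesB D) => //; apply: (multiples_w2 D Y); apply: OM => //;
    apply: OB.
have [phi' _ phiK] := injF_bij phi_inj.
exists (s (phi' (r x))) => //; apply/(res_eq D rP) => //; first exact: OX.
by rewrite -[LHS]phiK.
Qed.

(** The residue of [c] lies in the image of the Artin-Schreier map [T^2 + T]. *)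
Definition as_class c := exists2 t, O t & multiples O w (t ^+ 2 + t - c).

Lemma as_classP c : O c -> as_class c <-> exists2 y, O y & y ^+ 2 + y = c.
Proof.
move=> Oc; split=> [[t Ot]|[y Oy <-]]; first exact: (artin_schreier_lift D Y Oc Ot).
by exists y => //; rewrite subrr; apply: (multiples0 D).
Qed.

(** On the residue field [T^2 + T] is additive because 2 vanishes there, and its roots are 0 and -1
    = 1, so [kernel2_image] applies. *)
Lemma as_class_index2 :
  (exists2 c, O c & ~ as_class c) /\
  (forall c d, O c -> O d -> ~ as_class c -> ~ as_class d -> as_class (d - c)).
Proof.
have [s [sO sK]] := res_repr rP.
pose h v := r (s v ^+ 2 + s v).
have OAS x : O x -> O (x ^+ 2 + x) by move=> Ox; apply: OD => //; apply: OX.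
have hE t : O t -> h (r t) = r (t ^+ 2 + t).
  move=> Ot; apply/(res_eq D rP); [exact: OAS | exact: OAS |].
  have /(res_eq D rP (sO _) Ot) m : r (s (r t)) = r t by rewrite sK.
  have -> : s (r t) ^+ 2 + s (r t) - (t ^+ 2 + t)
    = (s (r t) + t + 1) * (s (r t) - t) by ring.
  by apply: (multiplesMl D) => //; do !apply: OD.
have asE c : O c -> as_class c <-> exists v, h v = r c.
  move=> Oc; split=> [[t Ot m]|[v Hv]].
    by exists (r t); rewrite hE //; apply/(res_eq D rP) => //; apply: OAS.
  exists (s v) => //; apply/(res_eq D rP) => //; exact: OAS.
have hD : {morph h : x y / x + y}.
  move=> u v; have -> : u + v = r (s u + s v) by rewrite (resD rP) // !sK.
  rewrite hE; last exact: OD.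
  rewrite /h -(resD rP); [|exact: OAS|exact: OAS].
  apply/(res_eq D rP).
  - exact/OAS/OD.
  - by apply: OD; apply: OAS.
  have -> : (s u + s v) ^+ 2 + (s u + s v) - (s u ^+ 2 + s u + (s v ^+ 2 + s v))
     = 2 * (s u * s v) by ring.
  by apply: (multiples_w2 D Y); apply: OM.
have r1 : r 1 != 0.
  apply/eqP => /(res_ker rP O1) m1; exact: (multiples_nonunit D m1 (units1 D)).
have hK v : h v = 0 <-> v = 0 \/ v = r 1.
  have r0 : r 0 = 0 by apply/(res_ker rP);
    [exact: (dvr0 D) | exact: (multiples0 D)].
  split; last first.
    case=> ->; first by rewrite -[in h 0]r0 hE ?expr0n ?addr0 //; exact: (dvr0 D).
    rewrite hE // expr1n; apply/(res_ker rP) => //.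
    by rewrite -[1 + 1]mulr1; apply: (multiples_w2 D Y).
  move/(res_ker rP (OAS _ (sO v))) => m.
  have [m1|U] := dvr_unitP D (sO v).
    by left; rewrite -(sK v); apply/(res_ker rP).
  right; rewrite -(sK v); apply/(res_eq D rP) => //.
  have -> : s v - 1 = (s v)^-1 * (s v ^+ 2 + s v) - 2 * 1.
    by field; apply: units_neq0 U.
  apply: (multiplesB D); last exact: (multiples_w2 D Y).
  by apply: (multiplesMl D) => //; apply: units_dvr (unitsV U).
have [[c Hc] Hcd] := kernel2_image hD r1 hK; split.
  by exists (s c) => // /(asE _ (sO c)) [v]; rewrite sK => /eqP; apply/negP.
move=> {c Hc} c d Oc Od nc nd; apply/asE; first exact: OB.
have rB : r (d - c) = r d - r c.
  by apply: (addIr (r c)); rewrite -(resD rP (OB Od Oc) Oc) !subrK.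
rewrite rB; apply: Hcd => v; apply/eqP => E.
  by apply: nc; apply/asE => //; exists v.
by apply: nd; apply/asE => //; exists v.
Qed.

(** With [b = t^2 + w d], [hensel] supplies [v] such that [b = t^2 (1 + v - c v^2)], a value of the
    norm form of discriminant [1 + 4c]. *)
Lemma unit_hilbert c b : O c -> units O b -> hilbert (1 + 4 * c) b = 1.
Proof.
move=> Oc Ub; have [t Ot [d Od Ed]] := residue_sqrt (units_dvr Ub).
have Ut : units O t.
  have [[z Oz Ez]|//] := dvr_unitP D Ot.
  have Eb : b = w * (d + z * t) by rewrite mulrDr mulrA Ed Ez -expr2 subrK.
  case: (multiples_nonunit D _ Ub); rewrite Eb; exists (d + z * t) => //.
  by apply: OD => //; apply: OM.
have t0 := units_neq0 Ut; have OVt := units_dvr (unitsV Ut).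
have [v wv Ev] := hensel D Y Oc (OM Od (OX 2 OVt)).
(* Completing the square: [4 t^2 (1 + v - c v^2) = (2t + tv)^2 - (1 + 4c) (tv)^2]. *)
apply/hilbertP; exists (t * v), 2, (2 * t + t * v); split.
  by rewrite !xpair_eqE (negPf two0) andbF.
have -> : b = t ^+ 2 * (1 + v - c * v ^+ 2); last by ring.
rewrite {1}Ev; apply/eqP; rewrite -subr_eq0; apply/eqP.
have -> : t ^+ 2 * (1 + (w * (d * t^-1 ^+ 2) + c * v ^+ 2) - c * v ^+ 2) = t ^+ 2
  + w * d.
  by field.
by rewrite Ed; ring.
Qed.

(* p^2 + p q + g q^2 is the norm form of the unramified quadratic extension. *)
Lemma norm_form_square g p q : O g ->
    (forall t, O t -> ~ multiples O w (t ^+ 2 + t + g)) -> (p, q) != (0, 0) ->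
  exists s u, [/\ s != 0, units O u & p ^+ 2 + p * q + g * q ^+ 2 = s ^+ 2 * u].
Proof.
move=> Og gP; rewrite xpair_eqE => pq0.
have [q0|q0] := eqVneq q 0.
  rewrite q0 eqxx andbT in pq0; exists p, 1; split=> //; first exact: units1 D.
  by rewrite q0; ring.
(* The square of the entry of smaller valuation is factored out: [(p/q)^2 + p/q + g] is a unit by
   [gP] if [p / q] is integral, and otherwise the cofactor is 1 modulo [w]. *)
have [Ox|[z Oz Ez]] := dvr_dichotomy D (p / q).
  exists q, ((p / q) ^+ 2 + p / q + g); split=> //; last by field.
  have [|//] := dvr_unitP D (OD (OD (OX 2 Ox) Ox) Og).
  by move=> m; case: (gP _ Ox).
rewrite invf_div in Ez.
(* Since [0^-1 = 0], this branch does not exclude [p = 0]. *)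
have [p0|p0] := eqVneq p 0.
  exists q, g; split=> //; last by rewrite p0; ring.
  have [m|//] := dvr_unitP D Og; case: (gP 0); first exact: dvr0 D.
  by rewrite expr0n !add0r.
exists p, (1 + q / p * (1 + g * (q / p))); split=> //; last by field.
have wqp : multiples O w (q / p) by exists z.
have Oqp := multiples_sub D Ow wqp.
apply: (unitsDm D (units1 D)); rewrite mulrC; apply: (multiplesMl D) => //.
by apply: OD => //; apply: OM.
Qed.

(** Equality would give the square of [t / s] an odd valuation; one of [t / s] and [s / t] is
    integral, so [dvr_val] can be applied to it. *)
Lemma odd_val_nsquare m n u v s t : units O u -> units O v -> s != 0 ->
  odd (m + n) -> w ^+ m * u * s ^+ 2 <> w ^+ n * v * t ^+ 2.
Proof.
move=> Uu Uv s0 odd_mn E.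
have u0 := units_neq0 Uu; have v0 := units_neq0 Uv.
have t0 : t != 0.
  apply: contra_eq_neq E => ->; rewrite expr0n mulr0.
  by rewrite !mulf_neq0 ?expf_neq0.
have aux i j a b x : units O a -> units O b -> odd (i + j) ->
    w ^+ i * a * x ^+ 2 = w ^+ j * b -> O x -> x != 0 -> False.
  move=> Ua Ub oij Ei Ox x0; have [k [c Uc Ec]] := dvr_val D Ox x0.
  have: w ^+ (i + k * 2) * (a * c ^+ 2) = w ^+ j * b.
    by rewrite -Ei Ec exprD exprM; ring.
  move/(dvr_val_inj D (unitsM D Ua (unitsX D 2 Uc)) Ub) => Eij.
  by move: oij; rewrite -Eij addnA addnn muln2 -doubleD odd_double.
have x0 : t / s != 0 by rewrite mulf_neq0 ?invr_eq0.
have [Ox|wx] := dvr_dichotomy D (t / s).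
  apply: (aux n m v u (t / s)) => //; first by rewrite addnC.
  by apply: (mulIf (expf_neq0 2 s0)); rewrite E; field.
apply: (aux m n u v (s / t)) => //.
- by apply: (mulIf (expf_neq0 2 t0)); rewrite -E; field.
- by have := multiples_sub D Ow wx; rewrite invf_div.
- by rewrite mulf_neq0 ?invr_eq0.
Qed.

(* With al * be = 4 g one has the identity of symbols
   (1 + al, 1 + be) = (1 - 4 g, al (1 + al) (1 + be)), in which the first entry
   is the discriminant of the anisotropic form p^2 + p q + g q^2 while the second
   has odd valuation. *)
Lemma ramified_hilbert k c : odd k -> (k < 2 * e)%N -> units O c ->
  exists2 b, units O b & hilbert (1 + w ^+ k * c) b <> 1.
Proof.
move=> odd_k lt_k Uc; have c0 := units_neq0 Uc.
have [[g' Og' nas] _] := as_class_index2; pose g := - g'.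
have Og : O g by apply: (dvrN D).
have gP t : O t -> ~ multiples O w (t ^+ 2 + t + g) by move=> Ot m; apply: nas;
  exists t.
have [u Uu E2] := dyadic2 Y; have u0 := units_neq0 Uu.
have E4 : w ^+ (2 * e) * u ^+ 2 = 4.
  by rewrite mulnC exprM -exprMn -E2 -natrX.
have Efour : 4 = w ^+ k * (w ^+ (2 * e - k) * u ^+ 2) :> K.
  by rewrite mulrA -exprD subnKC ?E4 // ltnW.
have [al Eal] : exists al, al = w ^+ k * c by eexists.
(* [be] is forced by [al * be = 4 * g]; the bound [k < 2 * e] puts it in [w O], which makes [1 + be]
   a unit. *)
have [be Ebe] : exists be, be = w ^+ (2 * e - k) * (u ^+ 2 * g / c) by eexists.
have wpos j z : (0 < j)%N -> O z -> multiples O w (w ^+ j * z).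
  move=> j0 Oz; exists (w ^+ j.-1 * z); first by apply: OM => //; apply: OX.
  by rewrite mulrA -exprS prednK.
have Oz : O (u ^+ 2 * g / c).
  by apply: OM (units_dvr (unitsV Uc)); apply: OM => //; apply: OX (units_dvr Uu).
have abE : al * be = 4 * g.
  by rewrite Efour Eal Ebe; field.
have Ual : units O (1 + al).
  by rewrite Eal; apply: (unitsDm D (units1 D)); apply: wpos (units_dvr Uc);
    case: (k) odd_k.
have Ube : units O (1 + be).
  by rewrite Ebe; apply: (unitsDm D (units1 D)); apply: wpos => //;
    rewrite subn_gt0.
exists (1 + be) => // /hilbertP[x [y [z [nz E]]]]; rewrite -Eal in E.
(* These linear forms carry the identity of symbols: the difference of the two sides of [PQS] is a
   multiple of the equation [E]. *)
pose S := z + x - y; pose Q := z + x + al * x.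
pose P := (1 + al) * (z + x) - al * (1 + be) * y.
have PQS : P ^+ 2 - (1 - al * be) * Q ^+ 2 = al * (1 + al) * (1 + be) * S ^+ 2.
  have -> : P ^+ 2 - (1 - al * be) * Q ^+ 2 = al * (1 + al) * (1 + be) * S ^+ 2
      + (1 - al * be) * al * (z ^+ 2 - ((1 + al) * x ^+ 2 + (1 + be) * y ^+ 2)).
    by rewrite /P /Q /S; ring.
  by rewrite E subrr mulr0 addr0.
have al0 : al != 0 by rewrite Eal mulf_neq0 ?expf_neq0.
have ab1 : 1 - al * be != 0.
  apply/units_neq0/(unitsDm D (units1 D))/(multiplesN D).
  have -> : al * be = 2 * (2 * g) by rewrite abE; ring.
  by apply: (multiples_w2 D Y); apply: OM.
have four0 : 4 != 0 :> K by rewrite -[4]/((2 * 2)%:R) natrM mulf_neq0.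
(* With [p = (P - Q) / 2] and [q = Q], [4 (p^2 + p q + g q^2) = P^2 - (1 - 4g) Q^2]. The pair is
   nonzero because [P = Q = 0] would force [x = y = z = 0]. *)
have pq0 : ((P - Q) / 2, Q) != (0, 0).
  apply: contra nz; rewrite !xpair_eqE mulf_eq0 invr_eq0 (negPf two0) orbF.
  case/andP=> /eqP PQ /eqP Q0; have P0 : P = 0 by rewrite -[P](subrK Q) PQ Q0 addr0.
  move/eqP: PQS; rewrite P0 Q0 !expr0n /= mulr0 subrr eq_sym !mulf_eq0.
  rewrite (negPf al0) (negPf (units_neq0 Ual)) (negPf (units_neq0 Ube)) /= orbb.
  rewrite subr_eq0 => /eqP zx; have zx0 : z + x = 0.
    apply/eqP; move/eqP: P0; rewrite /P -zx.
    have -> : (1 + al) * (z + x) - al * (1 + be) * (z + x) = (1 - al * be) * (z +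
      x).
      by ring.
    by rewrite mulf_eq0 (negPf ab1).
  move/eqP: Q0; rewrite /Q -zx zx0 add0r mulf_eq0 (negPf al0) /= => /eqP x0.
  by move: zx0; rewrite x0 addr0 => ->; rewrite !eqxx.
have [s [n [s0 Un En]]] := norm_form_square Og gP pq0.
(* The norm-form side has even valuation, the other side is [w ^+ k] times a unit times a square,
   and [k] is odd. *)
apply: (@odd_val_nsquare (2 * e) k (u ^+ 2 * n) (c * (1 + al) * (1 + be)) s S) =>
  //.
- by apply: (unitsM D) => //; apply: (unitsX D).
- by do !apply: (unitsM D).
- by rewrite oddD mul2n odd_double.
have -> : w ^+ (2 * e) * (u ^+ 2 * n) * s ^+ 2 = 4 * (s ^+ 2 * n).
  by rewrite mulrA E4; ring.
transitivity (P ^+ 2 - (1 - al * be) * Q ^+ 2); last by rewrite PQS Eal; ring.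
by rewrite -En abE; field; rewrite ?four0 ?two0.
Qed.
End Radical.

(** * Subgroups of the multiplicative group and their quotients *)

Definition mulgroup (K : fieldType) (A : set K) : Prop :=
  [/\ A 1, forall x y, A x -> A y -> A (x * y) &
      forall x, A x -> x != 0 /\ A x^-1].

Section Cosets.
Variable K : fieldType.
Implicit Types (A N P Q R : set K) (x y g h : K).

Lemma mulgroupI P Q : mulgroup P -> mulgroup Q -> mulgroup (P `&` Q).
Proof.
move=> [P1 PM PV] [Q1 QM QV]; split=> // [x y [Px Qx] [Py Qy]|x [Px Qx]].
  by split; [apply: PM | apply: QM].
by have [x0 ?] := PV x Px; have [_ ?] := QV x Qx.
Qed.

Lemma coset_eq N g h : mulgroup N -> g != 0 -> h != 0 ->
  [set g * n | n in N] = [set h * n | n in N] <-> N (g^-1 * h).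
Proof.
move=> [N1 NM NV] g0 h0; split=> [E|Ngh].
  have [n Nn Eh] : [set g * n | n in N] h by rewrite E; exists 1; rewrite ?mulr1.
  by rewrite -Eh mulKf.
have [_ NVgh] := NV _ Ngh.
rewrite predeqE => x; split=> -[n Nn <-].
  exists ((g^-1 * h)^-1 * n); first exact: NM.
  by field; rewrite g0 h0.
exists ((g^-1 * h) * n); first exact: NM.
by field; rewrite g0.
Qed.

Lemma coset_mul N g h : mulgroup N ->
  setop *%R [set g * n | n in N] [set h * n | n in N] = [set g * h * n | n in N].
Proof.
move=> [N1 NM NV]; rewrite predeqE => x; split.
  move=> [_ [n Nn <-] [_ [m Nm <-] <-]]; exists (n * m); first exact: NM.
  by rewrite mulrACA.
move=> [n Nn <-]; exists (g * 1); first by exists 1.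
by exists (h * n); [exists n | rewrite mulr1 mulrA].
Qed.

Lemma coset1 N : [set 1 * n | n in N] = N.
Proof.
by rewrite predeqE => x; split=> [[n Nn <-]|Nx]; [rewrite mul1r | exists x;
  rewrite ?mul1r].
Qed.

(** The isomorphism is [X -> X Q]; by [fE] it sends the coset of [g] modulo the intersection to the
    coset of [g] modulo [Q]. *)
Lemma second_iso P Q : mulgroup P -> mulgroup Q ->
  group_iso (setop *%R) (cosets *%R P (P `&` Q))
            (setop *%R) (cosets *%R (setop *%R P Q) Q).
Proof.
move=> gP gQ; have gI := mulgroupI gP gQ.
have [P1 PM PV] := gP; have [Q1 QM QV] := gQ.
have fE g : setop *%R [set g * n | n in P `&` Q] Q = [set g * n | n in Q].
  rewrite predeqE => x; split.
    move=> [_ [n [Pn Qn] <-] [m Qm <-]]; exists (n * m); first exact: QM.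
    by rewrite mulrA.
  move=> [n Qn <-]; exists (g * 1); first by exists 1.
  by exists n => //; rewrite mulr1.
exists (fun X => setop *%R X Q); split; last first.
  move=> _ _ [g Pg <-] [h Ph <-]; rewrite coset_mul // !fE coset_mul //.
  by split=> //; exists (g * h) => //; apply: PM.
split.
- move=> _ [g Pg <-]; rewrite fE; exists g => //; exists g => //.
  by exists 1; rewrite ?mulr1.
- move=> X X'; rewrite !inE => -[g Pg <-] [h Ph <-].
  have [g0 PVg] := PV g Pg; have [h0 PVh] := PV h Ph.
  rewrite !fE => /(coset_eq gQ g0 h0) Qgh; apply/(coset_eq gI g0 h0); split=> //.
  exact: PM.
- move=> _ [_ [p Pp [q Qq <-]] <-]; exists [set p * n | n in P `&` Q];
  first by exists p.
  have [p0 _] := PV p Pp; have [q0 _] := QV q Qq.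
  rewrite fE; apply/(coset_eq gQ) => //; first exact: mulf_neq0.
  by rewrite mulKf.
Qed.

(** The map [f] sends [Q] to 0 and every other coset to 1; the last hypothesis leaves only one other
    coset. *)
Lemma index2_iso R Q : mulgroup R -> mulgroup Q -> Q `<=` R ->
    (exists2 g, R g & ~ Q g) ->
    (forall g h, R g -> R h -> ~ Q g -> ~ Q h -> Q (g * h)) ->
  group_iso (setop *%R) (cosets *%R R Q) +%R [set: 'Z_2].
Proof.
move=> gR gQ QR [g0 Rg0 nQg0] nQM.
have [R1 RM RV] := gR; have [Q1 QM QV] := gQ.
pose f (X : set K) : 'Z_2 := if `[< X = Q >] then 0 else 1.
have fE g : R g -> f [set g * n | n in Q] = if `[< Q g >] then 0 else 1.
  move=> Rg; have [gn0 RVg] := RV g Rg; rewrite /f.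
  congr (if _ then _ else _); apply: asbool_equiv_eq.
  rewrite -[X in _ = X]coset1 coset_eq ?oner_eq0 // mulr1.
  by split=> [/QV[_]|/QV[_ //]]; rewrite invrK.
have QMl g h : R g -> Q h -> Q (g * h) -> Q g.
  by move=> Rg Qh Qgh; have [h0 QVh] := QV h Qh; rewrite -(mulfK h0 g); apply: QM.
exists f; split; last first.
  move=> _ _ [g Rg <-] [h Rh <-]; rewrite coset_mul //; have Rgh := RM _ _ Rg Rh.
  split; first by exists (g * h).
  rewrite !fE //; have [Qg|nQg] := pselect (Q g); have [Qh|nQh] := pselect (Q h).
  - by rewrite (asboolT (QM _ _ Qg Qh)) (asboolT Qg) (asboolT Qh) addr0.
  - rewrite (asboolT Qg) (asboolF nQh) add0r asboolF // => Qgh.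
    by apply: nQh; apply: (QMl h g) => //; rewrite mulrC.
  - rewrite (asboolF nQg) (asboolT Qh) addr0 asboolF // => Qgh.
    by apply: nQg; apply: (QMl g h).
  - rewrite (asboolT (nQM _ _ Rg Rh nQg nQh)) (asboolF nQg) (asboolF nQh).
    exact: val_inj.
split=> //.
- move=> X X'; rewrite !inE => -[g Rg <-] [h Rh <-].
  have [gn0 RVg] := RV g Rg; have [hn0 RVh] := RV h Rh.
  rewrite !fE // => E; apply/(coset_eq gQ) => //.
  move: E; case: asboolP => Qg; case: asboolP => Qh // _.
    by apply: QM => //; have [] := QV g Qg.
  apply: nQM => // /QV[_]; rewrite invrK; exact: Qg.
- move=> i _; have [i0|i1] : i = 0 \/ i = 1.
    by case: i => -[|[|m]] // lt_m; [left | right]; apply: val_inj.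
  + exists [set 1 * n | n in Q]; first by exists 1.
    by rewrite fE // i0; case: asboolP.
  + exists [set g0 * n | n in Q]; first by exists g0.
    by rewrite fE // i1; case: asboolP.
Qed.

End Cosets.

(** * Filtration of the units and structure of the radical *)

Section RadicalGroups.
Variables (K : fieldType) (O : set K) (w : K) (e : nat).
Variables (V : finZmodType) (r : K -> V).
Hypotheses (D : dvr O w) (Y : dyadic O w e) (rP : residue_map O w r).

Let O1 := dvr1 D.
Let OD x y := dvrD D (x := x) (y := y).
Let OB x y := dvrB D (x := x) (y := y).
Let OM x y := dvrM D (x := x) (y := y).
Let OX x n := dvrX D (x := x) n.
Let Ow := dvrw D.
Let O2 : O 2 := dyadic_2 D.

Definition principal_units n : set K := [set 1 + x | x in multiples O (w ^+ n)].
Definition squares : set K := [set u ^+ 2 | u in units O].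
Definition radical : set K :=
  [set a | units O a /\ forall b, units O b -> hilbert a b = 1].

Lemma principal_units_unit n x : (0 < n)%N -> principal_units n x -> units O x.
Proof.
move=> n0 [y /(multiplesX D n0) wy <-]; rewrite expr1 in wy.
exact: (unitsDm D (units1 D)).
Qed.

Lemma mulgroup_principal_units n : (0 < n)%N -> mulgroup (principal_units n).
Proof.
move=> n0; split.
- by exists 0; [apply: (multiples0 D) | rewrite addr0].
- move=> _ _ [x mx <-] [y my <-]; exists (x + (1 + x) * y); last by ring.
  apply: (multiplesD D) => //; apply: (multiplesMl D) => //; apply: OD => //.
  exact: (multiples_sub D (OX n Ow) mx).
- move=> x Px; have Ux := principal_units_unit n0 Px.
  have x0 := units_neq0 Ux; split=> //; case: Px => y my E.
  exists (- (x^-1 * y)).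
    by apply/(multiplesN D)/(multiplesMl D) => //; apply: units_dvr (unitsV Ux).
  by have -> : y = x - 1 by [rewrite -E addrC addKr]; field.
Qed.

Lemma mulgroup_squares : mulgroup squares.
Proof.
split.
- by exists 1; [apply: (units1 D) | rewrite expr1n].
- move=> _ _ [x Ux <-] [y Uy <-]; exists (x * y); first exact: (unitsM D).
  by rewrite exprMn.
- move=> _ [x Ux <-]; split; first by rewrite expf_neq0 // (units_neq0 Ux).
  by exists x^-1; [apply: unitsV | rewrite exprVn].
Qed.

(** 4 is [w ^+ (2 * e)] times the square of a unit; this passes from the filtration to the form
    [1 + 4c] of the Hensel criterion. *)
Lemma principal_units_4 x :
  principal_units (2 * e) x <-> exists2 c, O c & x = 1 + 4 * c.
Proof.
have [u Uu E2] := dyadic2 Y; have u0 := units_neq0 Uu.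
have -> : 4 = w ^+ (2 * e) * u ^+ 2 :> K.
  by rewrite mulnC exprM -exprMn -E2 -natrX.
have Uu2 := unitsX D 2 Uu.
split=> [[_ /(multiples_unit D _ _ Uu2)[c Oc <-] <-]|[c Oc ->]]; first by exists c.
exists (w ^+ (2 * e) * u ^+ 2 * c) => //.
by apply/(multiples_unit D _ _ Uu2); exists c.
Qed.

Lemma one_plus4_square c : O c -> squares (1 + 4 * c) <-> as_class O w c.
Proof.
move=> Oc; rewrite (as_classP D Y Oc) -(square_one_plus4 D Y Oc).
by split=> -[s Us Es]; exists s.
Qed.

(** Such an element is [1 + 4 w d], and [T^2 + T - w d] has the root 0 modulo [w]. *)
Lemma principal_units_sub_squares : principal_units (2 * e).+1 `<=` squares.
Proof.
move=> x [y [c Oc <-] <-].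
have [d Od E] : exists2 d, O d & 1 + w ^+ (2 * e) * c = 1 + 4 * d.
  by apply/principal_units_4; exists (w ^+ (2 * e) * c) => //; exists c.
have {}E : w ^+ (2 * e) * c = 4 * d by apply: (addrI 1).
have -> : 1 + w ^+ (2 * e).+1 * c = 1 + 4 * (w * d).
  by rewrite exprS -mulrA E; ring.
apply/one_plus4_square; first exact: OM.
exists 0; first exact: (dvr0 D).
by rewrite expr0n !add0r; apply: (multiplesN D); exists d.
Qed.

(** Induction on the level [n]. At an even level below [2 * e], the leading coefficient is a square
    modulo [w] and is absorbed into the square factor; an odd level with unit coefficient stops the
    process. *)
Lemma unit_normal_form a : units O a ->
  (exists s c, [/\ units O s, O c & a = s ^+ 2 * (1 + w ^+ (2 * e) * c)]) \/
  (exists s k c, [/\ units O s, odd k, (k < 2 * e)%N, units O c &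
     a = s ^+ 2 * (1 + w ^+ k * c)]).
Proof.
move=> Ua; set bad := (X in _ \/ X).
have [u Uu E2] := dyadic2 Y.
have e0 : (0 < 2 * e)%N by rewrite muln_gt0 (dyadic_gt0 Y).
suff H n : (0 < n <= 2 * e)%N ->
    (exists s c, [/\ units O s, O c & a = s ^+ 2 * (1 + w ^+ n * c)]) \/ bad.
  by apply: H; rewrite e0 leqnn.
elim: n => // -[_ _|n IH] => [|/andP[_ lt_n]].
  (* Level 1: every unit is a square modulo [w]. *)
  have [t Ot [d Od Ed]] := residue_sqrt D Y rP (units_dvr Ua).
  have Ut : units O t.
    have [wt|//] := dvr_unitP D Ot; case: (multiples_nonunit D _ Ua).
    rewrite -[a](subrK (t ^+ 2)); apply: (multiplesD D); first by exists d.
    by rewrite expr2; apply: (multiplesMl D).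
  left; exists t, (d / t ^+ 2); split=> //.
    by apply: OM => //; apply: units_dvr (unitsV (unitsX D 2 Ut)).
  rewrite -[a](subrK (t ^+ 2)) -Ed expr1; field; exact: units_neq0 Ut.
have [//|[s [c [Us Oc Ea]]]|] := IH _; [exact: ltnW | | by right].
have [[z Oz Ez]|Uc] := dvr_unitP D Oc.
  by left; exists s, z; split=> //; rewrite Ea -Ez [w ^+ n.+2]exprSr -mulrA.
have [odd_n|even_n] := boolP (odd n.+1).
  by right; exists s, n.+1, c.
left.
have [j Ej] : exists j, n.+1 = (j.+1 * 2)%N.
  exists (n.+1./2).-1; rewrite prednK ?half_gt0 //.
    by rewrite muln2 -[LHS]odd_double_half (negPf even_n).
  by case: (n) even_n.
have lt_j : (j.+1 < e)%N by rewrite -(ltn_pmul2r (isT : 0 < 2)%N) -Ej mulnC.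
have [t Ot [d Od Ed]] := residue_sqrt D Y rP Oc.
have U1 : units O (1 + w ^+ j.+1 * t).
  apply: (unitsDm D (units1 D)); exists (w ^+ j * t); last by rewrite exprS mulrA.
  by apply: OM => //; apply: OX.
have Oe k : O (w ^+ k) by apply: OX.
(* The cross term [2 w^(j+1) t] has valuation at least [e + j + 1], which exceeds
   [n + 1 = 2 (j + 1)] because [j + 1 < e]; hence it goes into the new coefficient. *)
exists (s * (1 + w ^+ j.+1 * t)), ((d - w ^+ (e - j.+2) * u * t) / (1 + w ^+ j.+1
  * t) ^+ 2).
split; first exact: (unitsM D).
  apply: OM; last by apply: units_dvr (unitsV (unitsX D 2 U1)).
  by apply: OB => //; do 2!apply: OM => //; apply: units_dvr.
have u1 := units_neq0 U1.
rewrite Ea exprMn -[RHS]mulrA; congr (_ * _).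
have -> : c = w * d + t ^+ 2 by rewrite Ed subrK.
have E2' : 2 = w ^+ j.+1 * w * w ^+ (e - j.+2) * u.
  by rewrite -exprSr -exprD subnKC.
have -> : (1 + w ^+ j.+1 * t) ^+ 2 * (1 + w ^+ n.+2 *
    ((d - w ^+ (e - j.+2) * u * t) / (1 + w ^+ j.+1 * t) ^+ 2)) =
   (1 + w ^+ j.+1 * t) ^+ 2 + w ^+ n.+1 * w * (d - w ^+ (e - j.+2) * u * t).
  by rewrite [w ^+ n.+2]exprSr; field.
have En : w ^+ n.+1 = w ^+ j.+1 * w ^+ j.+1 by rewrite Ej exprM.
have -> : (1 + w ^+ j.+1 * t) ^+ 2 = 1 + 2 * (w ^+ j.+1 * t) + w ^+ n.+1 * t ^+ 2.
  by rewrite En; ring.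
by rewrite E2' En; ring.
Qed.

(** [unit_hilbert] gives one inclusion; for the other, [ramified_hilbert] rules out the odd levels
    left by [unit_normal_form]. *)
Lemma radicalE : setop *%R (principal_units (2 * e)) squares = radical.
Proof.
have e0 : (0 < 2 * e)%N by rewrite muln_gt0 (dyadic_gt0 Y).
rewrite predeqE => a; split.
  move=> [p Pp [_ [s Us <-] <-]]; split.
    apply: (unitsM D); first exact: principal_units_unit e0 Pp.
    exact: (unitsX D).
  move=> b Ub; apply: hilbert_mul_square; first exact: units_neq0 Us.
  by have /principal_units_4[c Oc ->] := Pp; apply: unit_hilbert D Y rP _ _ Oc Ub.
case=> Ua Ha; have [[s [c [Us Oc Ea]]]|] := unit_normal_form Ua.
  exists (1 + w ^+ (2 * e) * c).
    by exists (w ^+ (2 * e) * c) => //; exists c.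
  by exists (s ^+ 2); [exists s | rewrite Ea mulrC].
move=> [s [k [c [Us odd_k lt_k Uc Ea]]]]; have s0 := units_neq0 Us.
have [b Ub] := ramified_hilbert D Y rP odd_k lt_k Uc; case.
have -> : 1 + w ^+ k * c = a * s^-1 ^+ 2 by rewrite Ea; field.
by apply: hilbert_mul_square; [rewrite invr_eq0 | apply: Ha].
Qed.

(** Closure under products and inverses is read off [radicalE], which presents the radical as a
    product of two subgroups. *)
Lemma mulgroup_radical : mulgroup radical.
Proof.
have e0 : (0 < 2 * e)%N by rewrite muln_gt0 (dyadic_gt0 Y).
have [P1 PM PV] := mulgroup_principal_units e0; have [S1 SM SV] := mulgroup_squares.
rewrite -radicalE; split.
- by exists 1 => //; exists 1; rewrite ?mulr1.
- move=> _ _ [p Pp [q Sq <-]] [p' Pp' [q' Sq' <-]].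
  by exists (p * p'); [apply: PM | exists (q * q'); [apply: SM | rewrite mulrACA]].
- move=> _ [p Pp [q Sq <-]]; have [p0 PVp] := PV p Pp; have [q0 SVq] := SV q Sq.
  split; first exact: mulf_neq0.
  by exists p^-1 => //; exists q^-1; rewrite ?invfM.
Qed.

Lemma squares_sub_radical : squares `<=` radical.
Proof.
move=> x Sx; rewrite -radicalE; exists 1; first by exists 0;
  [apply: (multiples0 D) | rewrite addr0].
by exists x; rewrite ?mul1r.
Qed.

Lemma radical_index2 :
  group_iso (setop *%R) (cosets *%R radical squares) +%R [set: 'Z_2].
Proof.
have gS := mulgroup_squares; have [S1 SM SV] := gS.
have [[c Oc nc] as2] := as_class_index2 D Y rP.
apply: (index2_iso mulgroup_radical gS squares_sub_radical).
  exists (1 + 4 * c); last by rewrite one_plus4_square.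
  rewrite -radicalE; exists (1 + 4 * c); first by apply/principal_units_4; exists c.
  by exists 1; rewrite ?mulr1.
rewrite -radicalE => _ _ [_ /principal_units_4[a Oa ->] [s Ss <-]]
  [_ /principal_units_4[b Ob ->] [t St <-]] na nb.
have nas x y : O x -> squares y -> ~ squares ((1 + 4 * x) * y) -> ~ as_class O w x.
  by move=> Ox Sy nxy /(one_plus4_square Ox) Sx; apply: nxy; apply: SM.
rewrite mulrACA; apply: (SM); last exact: (SM).
have O4ab : O (a + b + 4 * a * b).
  rewrite (_ : 4 * a * b = 2 * (2 * (a * b))); last by ring.
  by apply: OD; [apply: OD | do !apply: OM].
have -> : (1 + 4 * a) * (1 + 4 * b) = 1 + 4 * (a + b + 4 * a * b) by ring.
apply/one_plus4_square => //.
have [x Ox mx] := as2 a b Oa Ob (nas _ _ Oa Ss na) (nas _ _ Ob St nb).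
exists x => //.
(* The Artin-Schreier class of the product is that of [b - a], since [a + b + 4ab] and [b - a] agree
   modulo 2. *)
have -> : x ^+ 2 + x - (a + b + 4 * a * b) =
   x ^+ 2 + x - (b - a) - 2 * (a + 2 * (a * b)) by ring.
apply: (multiplesB D) => //; apply: (multiples_w2 D Y).
by apply: OD => //; apply: OM => //; apply: OM.
Qed.

End RadicalGroups.

(** * The index of the radical *)

(** For an endomorphism, kernel and cokernel have the same order: both equal the order of [G]
    divided by that of the image. *)
Lemma index_morphim_ker (gT : finGroupType) (G : {group gT}) (f : {morphism G >->
  gT}) :
  (f @* G)%g \subset G -> #|G : (f @* G)%g|%g = #|('ker f)%g|.
Proof.
have sKG : ('ker f)%g \subset G by apply: finset.subsetIl.
move=> sfG; have := Lagrange sKG; have := Lagrange sfG.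
rewrite card_morphim finset.setIid => <- /eqP; rewrite mulnC.
by rewrite eqn_pmul2l // => /eqP.
Qed.

(** [phi] maps [U] onto [G] and [R] is the preimage of [H], so [X -> phi X] is a bijection onto the
    left cosets of [H], numbered by an enumeration. *)
Lemma card_cosets (K : fieldType) (U R : set K) (gT : finGroupType)
    (G H : {group gT}) (phi : K -> gT) :
    mulgroup U -> mulgroup R -> {in U &, {morph phi : x y / x * y >-> (x * y)%g}} ->
    (forall p, p \in G <-> exists2 u, U u & phi u = p) ->
    H \subset G -> R `<=` U -> (forall u, U u -> (R u <-> phi u \in H)) ->
  cosets *%R U R #= `I_#|G : H|%g.
Proof.
move=> [U1 UM UV] gR phiM GE sHG RU RE.
pose f (X : set K) := [set p | `[< exists2 x, X x & phi x = p >]]%SET.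
have phiV u : U u -> phi u^-1 = (phi u)^-1%g.
  have E1 : phi 1 = 1%g.
    by apply: (mulgI (phi 1)); rewrite -phiM ?inE // mulr1 mulg1.
  move=> Uu; have [u0 UVu] := UV u Uu; apply: (mulgI (phi u)).
  by rewrite -phiM ?inE // divff // mulgV.
have fE u : U u -> f [set u * x | x in R] = (phi u *: H)%g.
  move=> Uu; have [u0 UVu] := UV u Uu.
  apply/setP => p; rewrite inE mem_lcoset; apply/asboolP/idP.
    move=> [_ [x Rx <-] <-]; have Ux := RU x Rx.
    by rewrite phiM ?inE // mulKg; apply/RE.
  move=> Hp; have /GE[x Ux Ex] : ((phi u)^-1 * p)%g \in G by apply:
    (fintype.subsetP sHG).
  exists (u * x); last by rewrite phiM ?inE // Ex mulKVg.
  by exists x => //; apply/RE => //; rewrite Ex.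
pose L := enum (lcosets H G).
have fL X : cosets *%R U R X -> f X \in L.
  move=> [u Uu <-]; rewrite fE // mem_enum; apply/lcosetsP.
  by exists (phi u) => //; apply/GE; exists u.
rewrite -card_lcosets cardE -/L.
apply/card_set_bijP; exists (fun X => index (f X) L); split.
- by move=> X /fL; rewrite -index_mem.
- move=> X X'; rewrite !inE => XC XC' /(congr1 (nth finset.set0 L)).
  rewrite !nth_index ?fL //; case: XC XC' => [u Uu <-] [v Uv <-]; rewrite !fE //.
  have [u0 UVu] := UV u Uu; have [v0 _] := UV v Uv => E.
  apply/(coset_eq gR u0 v0)/RE; first exact: UM.
  by rewrite phiM ?inE // phiV // -mem_lcoset E lcoset_refl.
- move=> i /= lt_i; have : nth finset.set0 L i \in L by rewrite mem_nth.
  rewrite mem_enum => /lcosetsP[p /GE[u Uu <-] E].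
  exists [set u * x | x in R]; first by exists u.
  by rewrite fE // -E index_uniq // enum_uniq.
Qed.

Section UnitIndex.
Variables (K : fieldType) (O : set K) (w : K) (e : nat).
Variables (V : finZmodType) (r : K -> V).
Hypotheses (D : dvr O w) (Y : dyadic O w e) (rP : residue_map O w r).

Let O1 := dvr1 D.
Let OD x y := dvrD D (x := x) (y := y).
Let OB x y := dvrB D (x := x) (y := y).
Let OM x y := dvrM D (x := x) (y := y).
Let O2 : O 2 := dyadic_2 D.
Let two0 : 2 != 0 :> K := dyadic_2_neq0 D Y.

Lemma mulgroup_units : mulgroup (units O).
Proof.
split=> [|x y|x Ux]; [exact: (units1 D)|exact: (unitsM D)|].
by split; [apply: units_neq0 Ux | apply: unitsV].
Qed.

Lemma finite_quotient_2X n : exists (T : finType) (q : K -> T) (s : T -> K),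
  #|T| = (#|V| ^ (e * n))%N /\ finite_quotient O (2 ^+ n) q s.
Proof.
have [T [q [s [cT [sO sK qE]]]]] := finite_quotient_exists D rP (e * n).
exists T, q, s; split=> //; split=> // x y Ox Oy.
by rewrite (multiples_2X D Y); apply: qE.
Qed.

(** * The units modulo [a] as a permutation group *)

Section Action.
Variables (a : K) (T : finType) (q : K -> T) (s : T -> K).
Hypothesis qP : finite_quotient O a q s.

(** Multiplication by [u] on [O / a O]; this embeds the units modulo [a] in a finite group although
    [T] has no ring structure. For a unit the search succeeds, so the default 1 only concerns other
    [u]. *)
Definition unit_perm (u : K) : {perm T} :=
  odflt 1%g [pick p : {perm T} | [forall t, p t == q (u * s t)]].

Lemma fq_reprE x : O x -> multiples O a (s (q x) - x).
Proof. by move=> Ox; apply/(fq_eq qP (fq_repr qP _) Ox); apply: fq_reprK qP _. Qed.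

Lemma fq_mul u x y : O u -> O x -> O y -> q x = q y -> q (u * x) = q (u * y).
Proof.
move=> Ou Ox Oy /(fq_eq qP Ox Oy) m; apply/(fq_eq qP); [exact: OM | exact: OM |].
by rewrite -mulrBr; apply: (multiplesMl D).
Qed.

Lemma unit_permE u t : units O u -> unit_perm u t = q (u * s t).
Proof.
move=> Uu; have Ou := units_dvr Uu; have OVu := units_dvr (unitsV Uu).
have sO := fq_repr qP; have sK := fq_reprK qP.
rewrite /unit_perm; case: pickP => [p /forallP/(_ t)/eqP //|/= H].
have inj : injective (fun t => q (u * s t)).
  move=> t1 t2 E; rewrite -(sK t1) -(sK t2) -[s t1](mulKf (units_neq0 Uu)).
  by rewrite -[s t2](mulKf (units_neq0 Uu)); apply: fq_mul => //; apply: OM.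
by have /forallP[] := H (perm inj); move=> x; rewrite permE.
Qed.

Lemma unit_permM :
  {in units O &, {morph unit_perm : u v / u * v >-> (u * v)%g}}.
Proof.
move=> u v; rewrite !inE => Uu Uv; have sO := fq_repr qP.
have Ou := units_dvr Uu; have Ov := units_dvr Uv.
apply/permP => t; rewrite permM !unit_permE //; last exact: (unitsM D).
rewrite [u * v]mulrC -mulrA; apply: fq_mul => //; try exact: OM.
by rewrite (fq_reprK qP).
Qed.

Lemma unit_perm_eq u v : units O u -> units O v ->
  unit_perm u = unit_perm v <-> multiples O a (u - v).
Proof.
move=> Uu Uv; have sO := fq_repr qP.
have Ou := units_dvr Uu; have Ov := units_dvr Uv.
split=> [/permP/(_ (q 1))|m]; last first.
  apply/permP=> t; rewrite !unit_permE //; apply/(fq_eq qP); try exact: OM.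
  by rewrite -mulrBl mulrC; apply: (multiplesMl D).
rewrite !unit_permE // => /(fq_eq qP (OM Ou (sO _)) (OM Ov (sO _))) m.
(* The permutations are compared at the class of 1, whose representative [s (q 1)] is only congruent
   to 1 modulo [a]. *)
have -> : u - v = (u * s (q 1) - v * s (q 1)) - (u - v) * (s (q 1) - 1) by ring.
apply: (multiplesB D) => //; apply: (multiplesMl D); first exact: OB.
exact: fq_reprE.
Qed.

Definition unit_perms : {set {perm T}} :=
  [set p | `[< exists2 u, units O u & unit_perm u = p >]]%SET.

Lemma unit_permsP p : p \in unit_perms <-> exists2 u, units O u & unit_perm u = p.
Proof. by rewrite inE; split=> /asboolP. Qed.

Lemma unit_perms_group_set : group_set unit_perms.
Proof.
apply/group_setP; split; first apply/unit_permsP.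
  exists 1; first exact: (units1 D).
  apply: (mulgI (unit_perm 1)).
  by rewrite -unit_permM ?inE ?mulr1 ?mulg1 //; apply: (units1 D).
move=> p1 p2 /unit_permsP[u Uu <-] /unit_permsP[v Uv <-]; apply/unit_permsP.
by exists (u * v); [apply: (unitsM D) | rewrite unit_permM ?inE].
Qed.
Canonical unit_perms_group := group unit_perms_group_set.

Lemma unit_perms_comm : {in unit_perms &, forall p1 p2, (p1 * p2 = p2 * p1)%g}.
Proof.
move=> _ _ /unit_permsP[u Uu <-] /unit_permsP[v Uv <-].
by rewrite -!unit_permM ?inE // mulrC.
Qed.

Lemma unit_perms_sqr_morph :
  {in unit_perms &, {morph (fun p => p ^+ 2)%g : p1 p2 / (p1 * p2)%g}}.
Proof. by move=> p1 p2 G1 G2; apply: expgMn; apply: unit_perms_comm. Qed.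
Canonical unit_perms_sqr := Morphism unit_perms_sqr_morph.

End Action.

(** [y = (u - 1) / 2] satisfies [y^2 + y = (u^2 - 1) / 4], hence is integral. This identifies the
    kernel of squaring modulo 4. *)
Lemma square_mod4 u : units O u -> multiples O (2 ^+ 2) (u ^+ 2 - 1) ->
  exists2 y, O y & u = 1 + 2 * y.
Proof.
move=> Uu [c Oc Ec]; exists ((u - 1) / 2); last by field.
apply: (dvr_root_monic2 D O1 Oc); apply: (mulfI (expf_neq0 2 two0)).
by rewrite Ec; field.
Qed.

Lemma radical_index : cosets *%R (units O) (radical O) #= `I_(#|V| ^ e).
Proof.
have e0 : (0 < 2 * e)%N by rewrite muln_gt0 (dyadic_gt0 Y).
have [T4 [q4 [s4 [_ P4]]]] := finite_quotient_2X 2.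
have [T2 [q2 [s2 [cT2 P2]]]] := finite_quotient_2X 1.
have O4 : O (2 ^+ 2) by apply: (dvrX D).
pose G := unit_perms_group P4.
have [f fE] : exists f : {morphism G >-> {perm T4}}, forall p, f p = (p ^+ 2)%g.
  by exists (unit_perms_sqr P4).
pose phi := unit_perm q4 s4.
have phiM : {in units O &, {morph phi : x y / x * y >-> (x * y)%g}}.
  exact: (unit_permM P4).
have phi1 : phi 1 = 1%g.
  by apply: (mulgI (phi 1)); rewrite -phiM ?inE ?mulr1 ?mulg1 //; apply: (units1 D).
have GP p : p \in G <-> exists2 u, units O u & phi u = p by apply: unit_permsP.
have phi_eq u v : units O u -> units O v -> phi u = phi v <-> multiples O (2 ^+
  2) (u - v).
  exact: (unit_perm_eq P4).
have phi2 u : units O u -> (phi u ^+ 2)%g = phi (u ^+ 2).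
  by move=> Uu; rewrite expr2 phiM ?inE // expgS expg1.
have sfG : (f @* G)%g \subset G.
  by apply/fintype.subsetP=> _ /morphimP[p _ Gp ->]; rewrite fE; apply: groupX.
(* The kernel of squaring modulo 4 is parametrized by [O / 2O] through [t -> 1 + 2 s2 t]. *)
have -> : (#|V| ^ e = #|G : (f @* G)%g|%g)%N.
  rewrite index_morphim_ker // -[e in LHS]muln1 -cT2.
  have Usq t : units O (1 + 2 * s2 t).
    by apply: (unitsDm D (units1 D)); apply: (multiples_w2 D Y);
      apply: (fq_repr P2).
  pose g t := phi (1 + 2 * s2 t).
  have m24 x : multiples O (2 ^+ 2) (2 * x) -> multiples O (2 ^+ 1) x.
    move=> [z Oz Ez]; exists z => //; apply: (mulfI two0).
    by rewrite -Ez expr1 expr2 mulrA.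
  rewrite -(card_imset (f := g)); last first.
    move=> t t' /(phi_eq _ _ (Usq t) (Usq t')) m;
      rewrite -(fq_reprK P2 t) -(fq_reprK P2 t').
    apply/(fq_eq P2); [exact: (fq_repr P2)|exact: (fq_repr P2)|].
    apply: m24; move: m.
    by have -> : 1 + 2 * s2 t - (1 + 2 * s2 t') = 2 * (s2 t - s2 t') by ring.
  apply/esym/eq_card => p; apply/idP/imsetP => [Kp|[t _ ->]].
    have Gp : p \in G by apply: dom_ker Kp.
    have /GP[u Uu Eu] := Gp; have := mker Kp; rewrite fE -Eu phi2 // -phi1.
    move=> /(phi_eq _ _ (unitsX D 2 Uu) (units1 D))/(square_mod4 Uu)[y Oy Ey].
    exists (q2 y) => //; rewrite /g; apply/phi_eq => //.
    have -> : u - (1 + 2 * s2 (q2 y)) = - (2 * (s2 (q2 y) - y)) by rewrite Ey; ring.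
    have [z Oz <-] := fq_reprE P2 Oy; apply: (multiplesN D); exists z => //.
    by rewrite expr1 expr2 mulrA.
  apply/kerP; first by apply/GP; exists (1 + 2 * s2 t).
  rewrite fE phi2 // -phi1; apply/phi_eq; [exact: (unitsX D) | exact: (units1 D) |].
  exists (s2 t ^+ 2 + s2 t); last by ring.
  by apply: OD; [apply: (dvrX D)|]; apply: (fq_repr P2).
have [S1 SM SV] := mulgroup_squares D.
have RU : radical O `<=` units O by move=> x [].
apply: (card_cosets mulgroup_units (mulgroup_radical D Y rP) phiM GP sfG RU) => u
  Uu.
 (* Modulo 4 the factor [1 + 4c] disappears, so the radical is the preimage of the group of
    squares. *)
 rewrite -(radicalE D Y rP); split.
  move=> [_ /(principal_units_4 D Y)[c Oc ->] [_ [v Uv <-] E]].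
  have -> : phi u = f (phi v).
    rewrite fE phi2 //; apply/phi_eq => //; first exact: (unitsX D).
    exists (c * v ^+ 2); last by rewrite -E; ring.
    by apply: OM => //; apply: (dvrX D); apply: units_dvr.
  by apply: mem_morphim; apply/GP; exists v.
move=> /morphimP[_ _ /GP[v Uv <-]]; rewrite fE phi2 // => /phi_eq H.
have [c Oc Ec] := H Uu (unitsX D 2 Uv); have v0 := units_neq0 Uv.
exists (1 + 4 * (c / v ^+ 2)).
  apply/(principal_units_4 D Y); exists (c / v ^+ 2) => //.
  by apply: OM => //; apply: units_dvr (unitsV (unitsX D 2 Uv)).
exists (v ^+ 2); first by exists v.
have -> : u = v ^+ 2 + 2 ^+ 2 * c by rewrite Ec addrC subrK.
by field.
Qed.
End UnitIndex.

(** * The ring of 2-adic integers *)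

Lemma z2_doubleE (x : Z2adic) n : (2 * x) n = ((2 * x n) %% 2 ^+ n)%Z.
Proof. by rewrite mulr_natl mulr2n /= -mulr2n mulr_natl. Qed.

Lemma z2_range (x : Z2adic) : x 1 = 0 \/ x 1 = 1.
Proof.
have := z2_modE x 1; rewrite expr1 => E.
have := modz_ge0 (x 1) (isT : (2 : int) != 0);
  have := ltz_pmod (x 1) (isT : (0 < 2 :> int)).
by rewrite E; case: (x 1) => [[|[|m]]|m] //; [left | right].
Qed.

(** By induction on [n], every [d k] vanishes modulo [2 ^+ n]. *)
Lemma z2_tail0 (d : nat -> Z2adic) : (forall n, d n = 2 * d n.+1) -> d 0 = 0.
Proof.
move=> dE; suff H n k : d k n = 0 by apply: z2_inj => n; rewrite H /= mod0z.
elim: n k => [|n IH] k; first by rewrite -z2_modE expr0 modz1.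
rewrite dE z2_doubleE; have := IH k.+1; rewrite -(z2_mod _ n 1) addn1.
move=> /dvdz_mod0P/dvdzP[c ->]; apply/dvdz_mod0P/dvdzP; exists c.
by rewrite exprS mulrCA.
Qed.

(** Modulo [2 ^+ n] the series starting at [j] reduces to its first [n] terms, which is [u j n]. *)
Lemma z2_complete (z : nat -> Z2adic) :
  exists S : nat -> Z2adic, forall n, S n = z n + 2 * S n.+1.
Proof.
pose u j n : int := \sum_(k < n) 2 ^+ k * z (j + k)%N n.
have uP j n : (u j n.+1 %% 2 ^+ n)%Z = (u j n %% 2 ^+ n)%Z.
  rewrite /u big_ord_recr /= addrC mulrC modzMDl.
  apply: (big_ind2 (fun a b => (a %% 2 ^+ n = b %% 2 ^+ n)%Z)) => //.
    by move=> a b c d E1 E2; rewrite -modzDm E1 E2 modzDm.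
  by move=> k _; rewrite -modzMmr -z2valP.
pose S j := MkZ2adic (z2_lift (uP j)); exists S => j; apply: z2_inj => n.
change ((u j n %% 2 ^+ n)%Z = ((z j n + (2 * S j.+1) n) %% 2 ^+ n)%Z).
rewrite z2_doubleE /= modzDmr -modzDmr modzMmr modzDmr.
have -> : z j n + 2 * u j.+1 n = u j n + 2 ^+ n * z (j + n)%N n.
  rewrite -[RHS](big_ord_recr n (fun k : 'I_n.+1 => 2 ^+ k * z (j + k)%N n))
    big_ord_recl /=.
  rewrite addn0 expr0 mul1r mulr_sumr; congr (_ + _); apply: eq_bigr => k _.
  by rewrite exprS mulrA addnS addSn.
by rewrite addrC mulrC modzMDl.
Qed.

Lemma z2_half (x : Z2adic) : x 1 = 0 -> exists y, x = 2 * y.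
Proof.
(* The index shifts by one because halving loses one binary digit of precision. *)
move=> x1; pose h n := (x n.+1 %/ 2)%Z.
have hE n : x n.+1 = 2 * h n.
  rewrite /h mulrC divzK //; apply/dvdz_mod0P.
  by have := z2_mod x 1 n; rewrite add1n expr1 x1.
have hP n : (h n.+1 %% 2 ^+ n)%Z = (h n %% 2 ^+ n)%Z.
  have : x n.+1 = (x n.+2 %% 2 ^+ n.+1)%Z by rewrite z2valP.
  rewrite !hE exprS -(mulz_modr (isT : (0 < 2 :> int)%R)) => /(mulfI (isT : (2 :
    int) != 0)) ->.
  by rewrite modz_mod.
exists (MkZ2adic (z2_lift hP)); apply: z2_inj => n.
by rewrite z2_doubleE /= modzMmr -hE -z2valP.
Qed.

(** Writing [x = 1 - 2s], the inverse is the geometric series in [2s]; [z2_tail0] proves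
    [S 1 = s * S 0]. *)
Lemma z2_inverse (x : Z2adic) : x 1 != 0 -> exists y, x * y = 1.
Proof.
move=> x1; have [s Es] : exists s, 1 - x = 2 * s.
  apply: z2_half; have [E|E] := z2_range x; first by rewrite E eqxx in x1.
  by rewrite /= E.
have {Es} -> : x = 1 - 2 * s by rewrite -Es subKr.
have [S SE] := z2_complete (fun n => s ^+ n).
have : S 1 - s * S 0 = 0.
  apply: (z2_tail0 (d := fun n => S n.+1 - s * S n)) => n.
  by rewrite {1}(SE n.+1) {1}(SE n) exprS; ring.
move=> /eqP; rewrite subr_eq0 => /eqP E; exists (S 0).
by rewrite mulrBl mul1r -mulrA -E {1}(SE 0) addrK.
Qed.

(** Halving lowers the index of a nonzero component, so it must reach an odd element, which is
    invertible. *)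
Lemma z2_factor (x : Z2adic) : x != 0 -> exists k u v, x = 2 ^+ k * u /\ u * v = 1.
Proof.
case/z2_neq0P=> n; elim: n x => [|n IH] x.
  by rewrite -z2_modE expr0 modz1.
have [x1|x1 _] := eqVneq (x 1) 0; last first.
  by have [v xv] := z2_inverse x1; exists 0, x, v; rewrite mul1r.
have [y ->] := z2_half x1 => nz.
have [|k [u [v [-> uv]]]] := IH y; last by exists k.+1, u, v; rewrite exprS mulrA.
apply: contra nz => /eqP yn; rewrite z2_doubleE exprS -(mulz_modr (isT : (0 < 2
  :> int)%R)).
by move: yn; rewrite -(z2_mod _ n 1) addn1 => ->.
Qed.

Lemma z2_two_nonunit (x : Z2adic) : 2 * x != 1.
Proof.
apply/eqP => /(congr1 (fun y : Z2adic => y 1)).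
by rewrite z2_doubleE expr1 modzMr.
Qed.

Lemma z2_two_neq0 : 2 != 0 :> Z2adic.
Proof. by apply/eqP => /(congr1 (fun y : Z2adic => y 2)). Qed.

Lemma fraction_repr (R : idomainType) (x : {fraction R}) :
  exists a b, b != 0 /\ x * FracField.tofrac b = FracField.tofrac a.
Proof.
elim/quotW: x => x; exists (frac x).1, (frac x).2; split; first exact: denom_ratioP.
unlock FracField.tofrac; rewrite -[LHS]FracField.pi_mul; apply/eqmodP.
rewrite /= FracField.equivfE /FracField.mulf !numden_Ratio ?mulf_neq0
  ?denom_ratioP ?oner_neq0 //.
by rewrite !mulr1 mulrC.
Qed.

Lemma q2_dyadic (x : Q2adic) : exists k a, 2 ^+ k * x = FracField.tofrac a.
Proof.
have [a [b [b0 E]]] := fraction_repr x.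
have [k [u [v [Eb uv]]]] := z2_factor b0.
exists k, (a * v); rewrite tofracM -E Eb tofracM tofracXn.
have -> : FracField.tofrac (2 : Z2adic) = 2 by rewrite -[2]/(1 + 1) tofracD tofrac1.
by rewrite -!mulrA -tofracM uv tofrac1 mulr1 mulrC.
Qed.

(** * The ring of integers of a local field *)

Section RingOfIntegers.
Variable F : fieldExtType Q2adic.
Local Notation O := (ringint F).

Lemma Z2adic_to_is_zmod_morphism : zmod_morphism (@Z2adic_to F).
Proof. by move=> x y; rewrite /Z2adic_to tofracB scalerBl. Qed.
Lemma Z2adic_to_is_monoid_morphism : monoid_morphism (@Z2adic_to F).
Proof.
split=> [|x y]; first by rewrite /Z2adic_to tofrac1 scale1r.
by rewrite /Z2adic_to tofracM -scalerAl mul1r scalerA.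
Qed.
HB.instance Definition _ := GRing.isZmodMorphism.Build Z2adic F (@Z2adic_to F)
  Z2adic_to_is_zmod_morphism.
HB.instance Definition _ := GRing.isMonoidMorphism.Build Z2adic F (@Z2adic_to F)
  Z2adic_to_is_monoid_morphism.

Lemma Z2adic_to_inj : injective (@Z2adic_to F).
Proof.
move=> x y /eqP; rewrite -subr_eq0 -rmorphB /= /Z2adic_to scaler_eq0 oner_eq0 orbF.
by rewrite tofrac_eq0 subr_eq0 => /eqP.
Qed.

Lemma Z2adic_to2 : Z2adic_to F 2 = 2.
Proof. exact: rmorph_nat. Qed.

Lemma ringint_Z2adic x : O (Z2adic_to F x). Proof. exact: integral_id. Qed.
Lemma ringint1 : O 1. Proof. exact: integral1. Qed.
Lemma ringintB x y : O x -> O y -> O (x - y). Proof. exact: integral_sub. Qed.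
Lemma ringintM x y : O x -> O y -> O (x * y). Proof. exact: integral_mul. Qed.
Lemma ringintX x n : O x -> O (x ^+ n).
Proof.
by move=> Ox; elim: n => [|n IH]; [apply: ringint1 | rewrite exprS;
  apply: ringintM].
Qed.

Lemma ringint2 : O 2. Proof. by rewrite -Z2adic_to2; apply: ringint_Z2adic. Qed.

Lemma two_neq0 : 2 != 0 :> F.
Proof.
rewrite -Z2adic_to2 -(rmorph0 (@Z2adic_to F)) (inj_eq Z2adic_to_inj).
exact: z2_two_neq0.
Qed.

(** Multiplying a monic equation for 1/2 by [2 ^+ n] leaves the leading term 1 and makes all other
    terms even. *)
Lemma half_not_ringint : ~ O 2^-1.
Proof.
move=> [p mon_p /rootP pE]; set n := (size p).-1.
have sp : size p = n.+1 by rewrite prednK // lt0n size_poly_eq0 monic_neq0.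
have E : Z2adic_to F (\sum_(i < n.+1) p`_i * 2 ^+ (n - i)) = 0.
  rewrite -[RHS](mulr0 (2 ^+ n)) -pE (horner_coef_wide _ (_ : _ <= n.+1)%N);
    last first.
    by rewrite size_map_poly_id0 ?sp // (monicP mon_p) rmorph1 oner_neq0.
  rewrite rmorph_sum mulr_sumr; apply: eq_bigr => i _.
  rewrite coef_map rmorphM rmorphXn /= Z2adic_to2 mulrCA exprVn; congr (_ * _).
  by rewrite expfB_cond // (negPf two_neq0) add0n -ltnS.
have {}E : \sum_(i < n.+1) p`_i * 2 ^+ (n - i) = 0.
  by apply: Z2adic_to_inj; rewrite E rmorph0.
have /eqP[] := z2_two_nonunit (- \sum_(i < n) p`_i * 2 ^+ (n - i).-1).
rewrite mulrN mulr_sumr; apply/eqP; rewrite eqr_oppLR -addr_eq0 -[X in _ == X]E.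
rewrite big_ord_recr /= subnn mulr1;
  have -> : p`_n = 1 by rewrite -(monicP mon_p) lead_coefE.
apply/eqP; congr (_ + _); apply: eq_bigr => i _.
by rewrite mulrCA -exprS prednK // subn_gt0.
Qed.

(** A power [2 ^+ k] clears the denominators of the minimal polynomial of [x], and scaling its roots
    by [2 ^+ k] keeps it monic while making it integral. *)
Lemma ringint_dyadic (x : F) : exists k, O (2 ^+ k * x).
Proof.
have [p mon_p pE] : exists2 p : {poly F}, p \is monic & root p x /\
    {in p : seq F, forall c, exists k, O (2 ^+ k * c)}.
  exists (minPoly 1%AS x); first exact: monic_minPoly.
  split; first exact: root_minPoly.
  move=> c cP; have /polyOverP/(_ (index c (minPoly 1%AS x))) := minPolyOver 1%AS x.
  rewrite nth_index // => /vlineP[a ->]; have [k [b E]] := q2_dyadic a.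
  exists k; rewrite -scalerAr mulr1.
  have -> : a *: 2 ^+ k = Z2adic_to F b :> F.
    rewrite /Z2adic_to -E mulrC -scalerA; congr (_ *: _).
    by rewrite -in_algE rmorphXn rmorph_nat.
  exact: ringint_Z2adic.
case: pE => px pk.
have [k Hk] : exists k, forall i, O (2 ^+ k * p`_i).
  suff [k Hk] : exists k, {in p : seq F, forall c, O (2 ^+ k * c)}.
    exists k => i; have [lt_i|le_i] := ltnP i (size p); first exact/Hk/mem_nth.
    by rewrite nth_default // mulr0; apply: integral0.
  elim: (p : seq F) pk => [|c s IH] H; first by exists 0.
  have [k Hk] := H c (mem_head c s).
  have [l Hl] : exists l, {in s, forall c, O (2 ^+ l * c)}.
    by apply: IH => d ds; apply: H; rewrite inE ds orbT.
  exists (k + l)%N => d; rewrite inE => /orP[/eqP->|/Hl Od].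
    by rewrite addnC exprD -mulrA; apply: ringintM => //; apply/ringintX/ringint2.
  by rewrite exprD -mulrA; apply: ringintM => //; apply/ringintX/ringint2.
pose n := (size p).-1.
have sp : size p = n.+1 by rewrite prednK // lt0n size_poly_eq0 monic_neq0.
(* [q] has root [2 ^+ k * x]; below the leading term each coefficient gains at least one factor
   [2 ^+ k]. *)
exists k; pose q := \poly_(i < n.+1) (p`_i * 2 ^+ (k * (n - i))).
have lq : p`_n * 2 ^+ (k * (n - n)) = 1.
  by rewrite subnn muln0 mulr1 -(monicP mon_p) lead_coefE sp.
apply: (@integral_root_monic _ _ _ _ q).
- rewrite monicE lead_coefE size_poly_eq ?lq ?oner_neq0 //.
  by rewrite coef_poly ltnSn lq.
- apply/rootP; rewrite horner_poly; transitivity (2 ^+ (k * n) * p.[x]).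
    rewrite horner_coef sp mulr_sumr; apply: eq_bigr => i _.
    have le_in : (i <= n)%N by rewrite -ltnS.
    have -> : 2 ^+ (k * n) = 2 ^+ (k * (n - i)) * 2 ^+ (k * i) :> F.
      by rewrite -exprD -mulnDr subnK.
    by rewrite exprMn -exprM; ring.
  by rewrite (rootP px) mulr0.
- apply/integral_poly => i.
  rewrite coef_poly; case: ltnP => [|_]; last exact: integral0.
  rewrite ltnS leq_eqVlt => /orP[/eqP->|lt_in].
    by rewrite lq; apply: integral1.
  have -> : p`_i * 2 ^+ (k * (n - i)) = 2 ^+ (k * (n - i).-1) * (2 ^+ k * p`_i).
    rewrite mulrA -exprD addnC -mulnS prednK ?subn_gt0 //; exact: mulrC.
  by apply: ringintM => //; apply/ringintX/ringint2.
Qed.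

End RingOfIntegers.

(** * The ring of integers as a complete discrete valuation ring *)

Section LocalFieldDvr.
Variables (F : fieldExtType Q2adic) (w : F) (e f : nat).
Hypotheses (hw : uniformizer w) (he : ramification_index w e)
  (hf : inertia_degree F f).
Local Notation O := (ringint F).
Let two0 := two_neq0 F.

(** For nonzero [x] some [2 ^+ k / x] is integral, so divisibility of [x] by [2 ^+ k.+1] would make
    1/2 integral. *)
Lemma ringint_sep (x : F) : (forall n, multiples O (2 ^+ n) x) -> x = 0.
Proof.
move=> xP; have [//|x0] := eqVneq x 0; have [k Ok] := ringint_dyadic x^-1.
have [t Ot Et] := xP k.+1; case: (@half_not_ringint F).
have -> : 2^-1 = t * (2 ^+ k * x^-1); last exact: ringintM.
apply: (mulfI two0); rewrite divff // -[LHS](divff x0).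
by transitivity (2 ^+ k.+1 * t * x^-1);
  [rewrite Et | rewrite exprS -!mulrA (mulrCA t)].
Qed.

Lemma ramification_unit : exists2 u, units O u & 2 = w ^+ e * u.
Proof.
have O1 := @ringint1 F.
have [u Ou Eu] : principal (w ^+ e) 2 by rewrite -he; exists 1; rewrite ?mulr1.
have [v Ov Ev] : principal 2 (w ^+ e) by rewrite he; exists 1; rewrite ?mulr1.
exists u => //; split=> //; exists v => //.
by apply: (mulfI two0); rewrite mulrA [2 * u]mulrC -mulrA Ev mulr1 mulrC Eu.
Qed.

Lemma two_nonunit : ~ units O 2.
Proof.
move=> [_ [y Oy E]]; apply: (@half_not_ringint F).
by have -> : 2^-1 = y by apply: (mulfI two0); rewrite divff.
Qed.

Lemma ringint_dvr : dvr O w.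
Proof.
have [u [Ou _] Eu] := ramification_unit; have O2 := @ringint2 F.
have m2 : multiples O w 2.
  by have : maxideal F 2; [split; [exact: O2 | exact: two_nonunit] | rewrite hw].
split; [exact: ringint1|exact: ringintB|exact: ringintM|exact: hw| | |].
- by apply/eqP => w0; case: m2 => y _; rewrite w0 mul0r => /esym/eqP; apply/negP.
(* Divisibility by [w ^+ (e * n)] implies divisibility by [2 ^+ n]. *)
- move=> x xP; apply: ringint_sep => n; have [y Oy Ey] := xP (e * n)%N.
  have [v Ov Ev] : principal 2 (w ^+ e).
    by rewrite he; exists 1; [exact: ringint1 | rewrite mulr1].
  exists (v ^+ n * y); first by apply: ringintM => //; apply: ringintX.
  by rewrite mulrA -exprMn Ev -exprM.
- move=> x; have [k Ok] := ringint_dyadic x; exists (2 ^+ k); split=> //.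
    exact: ringintX.
  by rewrite expf_neq0.
Qed.

Lemma ramification_gt0 : (0 < e)%N.
Proof.
have [u Uu] := ramification_unit; case: e => [|//]; rewrite mul1r => E.
by case: two_nonunit; rewrite E.
Qed.

Lemma ringint_residue :
  exists r : F -> 'rV['F_2]_f, residue_map O w r.
Proof.
have D := ringint_dvr; have [g [[gfun ginj gsurj] gD]] := hf.
have mE : maxideal F = multiples O w by apply: hw.
pose c x := [set x + n | n in maxideal F].
have cP x : O x -> cosets +%R (ringint F) (maxideal F) (c x) by exists x.
have cD x y : O x -> O y -> setop +%R (c x) (c y) = c (x + y).
  move=> Ox Oy; rewrite /c mE predeqE => z; split.
    move=> [_ [m Mm <-] [_ [n Mn <-] <-]]; exists (m + n);
      first exact: (multiplesD D).
    by rewrite addrACA.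
  move=> [m Mm <-]; exists (x + 0); first by exists 0 => //; apply: (multiples0 D).
  by exists (y + m); [exists m | rewrite addr0 addrA].
have rD x y : O x -> O y -> g (c (x + y)) = g (c x) + g (c y).
  by move=> Ox Oy; rewrite -cD //; have [] := gD _ _ (cP x Ox) (cP y Oy).
have O0 : O 0 by apply: (dvr0 D).
have r0 : g (c 0) = 0 by apply: (addIr (g (c 0))); rewrite -rD // !add0r.
exists (fun x => g (c x)); split=> // [v|x Ox].
  by have [_ [x Ox <-] <-] := gsurj v I; exists x.
rewrite -r0; split=> [/ginj E|mx].
  have : c x x by exists 0; [rewrite mE; apply: (multiples0 D) | rewrite addr0].
  rewrite E ?inE; [|exact: cP|exact: cP].
  by move=> [m]; rewrite mE add0r => Mm <-.
congr g; rewrite /c mE predeqE => z; split=> -[m Mm <-].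
  by exists (x + m); [apply: (multiplesD D) | rewrite add0r].
by exists (m - x); [apply: (multiplesB D) | rewrite add0r addrC subrK].
Qed.

(* The representatives of O/2O generate O as a Z_2-module: expanding x in base 2
   gives a convergent sum in each coordinate, and the difference from x is
   divisible by every power of 2. *)
Lemma ringint_generators : exists (T : finType) (s : T -> F),
  (forall t, O (s t)) /\ forall x, O x ->
    exists a : T -> Z2adic, x = \sum_t Z2adic_to F (a t) * s t.
Proof.
have D := ringint_dvr; have [r rP] := ringint_residue.
have [T [q [s [_ [sO sK qE]]]]] := finite_quotient_exists D rP e.
have sqO x : O x -> O ((x - s (q x)) / 2).
  move=> Ox; have : principal (w ^+ e) (x - s (q x)).
    by apply/(qE _ _ Ox (sO _)); rewrite sK.
  by rewrite -he => -[y Oy <-]; rewrite mulrC mulKf.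
exists T, s; split=> // x Ox.
(* [X n] is the remainder after [n] digits and [q (X n)] the next digit; the coordinate at [t] sums
   the powers of 2 at which the digit is [t]. *)
pose X n := iter n (fun x => (x - s (q x)) / 2) x.
have XO n : O (X n) by elim: n => // n IH; apply: sqO.
have XE n : X n = s (q (X n)) + 2 * X n.+1 by rewrite /X /=; field.
have /choice[S SP] t := z2_complete (fun n => (t == q (X n))%:R).
exists (fun t => S t 0); apply/eqP; rewrite -subr_eq0; apply/eqP/ringint_sep => n.
pose M n := \sum_t Z2adic_to F (S t n) * s t.
have MO k : O (M k).
  by apply: big_ind => [|? ? |t _]; [exact: (dvr0 D)|exact: (dvrD D)|];
    apply: ringintM => //; apply: ringint_Z2adic.
have ME k : M k = s (q (X k)) + 2 * M k.+1.
  rewrite /M mulr_sumr -[s _](_ : \sum_t (t == q (X k))%:R * s t = _);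
    last first.
    rewrite (bigD1 (q (X k))) //= eqxx mul1r big1 ?addr0 // => t /negPf->.
    by rewrite mul0r.
  rewrite -big_split; apply: eq_bigr => t _ /=.
  by rewrite (SP t k) rmorphD rmorphM rmorph_nat /= Z2adic_to2; ring.
have E k : X 0 - M 0 = 2 ^+ k * (X k - M k).
  elim: k => [|k ->]; first by rewrite mul1r.
  by rewrite (XE k) (ME k) exprS; ring.
by exists (X n - M n); [apply: ringintB | rewrite -E].
Qed.

(** Completeness is inherited from the 2-adic integers coordinate by coordinate, with any choice of
    coordinates on the finite generating family. *)
Lemma ringint_dyadic_dvr : dyadic O w e.
Proof.
have D := ringint_dvr; have [T [s [sO sP]]] := ringint_generators.
split; [exact: ramification_gt0 | exact: ramification_unit |].
move=> x Ox; have /choice[a aP] n := sP _ (Ox n).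
have /choice[S SP] t := z2_complete (fun n => a n t).
exists (fun n => \sum_t Z2adic_to F (S t n) * s t) => n; split.
  by apply: big_ind => [|? ? |t _]; [exact: (dvr0 D)|exact: (dvrD D)|];
    apply: ringintM => //; apply: ringint_Z2adic.
rewrite aP mulr_sumr -big_split; apply: eq_bigr => t _ /=.
by rewrite (SP t n) rmorphD rmorphM /= Z2adic_to2; ring.
Qed.

End LocalFieldDvr.

Theorem proposition2p2 (F : fieldExtType Q2adic) (w : F) (e f : nat)
    (hw : uniformizer w) (he : ramification_index w e)
    (hf : inertia_degree F f) :
  [/\ setop *%R (one_plus (w ^+ (2 * e))) (unit_squares F)
        = hilbert_radical F
      /\ one_plus (w ^+ (2 * e).+1) `<=` unit_squares F,
      group_iso
        (setop *%R) (cosets *%R (one_plus (w ^+ (2 * e)))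
                       (one_plus (w ^+ (2 * e)) `&` unit_squares F))
        (setop *%R) (cosets *%R (hilbert_radical F) (unit_squares F))
      /\ group_iso
        (setop *%R) (cosets *%R (hilbert_radical F) (unit_squares F))
        +%R [set: 'Z_2]
    & cosets *%R (unitint F) (hilbert_radical F) #= `I_(2 ^ (e * f))].
Proof.
have D := ringint_dvr hw he; have Y := ringint_dyadic_dvr hw he hf.
have [r rP] := ringint_residue hw he hf.
have e0 : (0 < 2 * e)%N by rewrite muln_gt0 (dyadic_gt0 Y).
have RE : setop *%R (one_plus (w ^+ (2 * e))) (unit_squares F) = hilbert_radical F.
  exact: radicalE D Y rP.
split.
- by split=> //; apply: principal_units_sub_squares D Y.
- split; last exact: radical_index2 D Y rP.
  (* By (1) the radical is the product of the two subgroups, so this is the second isomorphism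
     theorem. *)
  rewrite -RE; apply: second_iso; last exact: mulgroup_squares D.
  exact: mulgroup_principal_units D _ e0.
- have -> : (2 ^ (e * f) = #|{: 'rV['F_2]_f}| ^ e)%N.
    by rewrite card_mx card_Fp // mul1n -expnM mulnC.
  exact: radical_index D Y rP.
Qed.
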